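(* Let $\mathsf{A}$ and $\mathsf{B}$ be finite essential square matrices with entries in $\mathbb{N}$, and let $m\ge 1$ be an integer. Then the following are equivalent: (1) $\mathsf{A}$ and $\mathsf{B}$ are aligned shift related with lag $m$; (2) $\mathsf{A}$ and $\mathsf{B}$ are balanced shift related with lag $m$; (3) $\mathsf{A}$ and $\mathsf{B}$ are compatible shift related with lag $m$. Consequently, $\mathsf{A}$ and $\mathsf{B}$ are aligned shift related with some lag if and only if they are strong shift equivalent (with some lag), and likewise they are balanced shift related with some lag if and only if they are strong shift equivalent (with some lag).
   Context: Here $\mathbb{N}=\{0,1,2,\dots\}$. A matrix is essential if it has no zero rows and no zero columns. For a $V\times W$ matrix $\mathsf{F}$ with entries in $\mathbb{N}$ let $E_{\mathsf{F}}=\{(v,\alpha,w): v\in V,\ w\in W,\ 0\le\alpha<\mathsf{F}_{vw}\}$, with $s(v,\alpha,w)=v$ and $r(v,\alpha,w)=w$. For matrices $\mathsf{A}_1,\dots,\mathsf{A}_n$ such that the column index set of $\mathsf{A}_i$ equals the row index set of $\mathsf{A}_{i+1}$, the fibered product is $E_{\mathsf{A}_1}\times\cdots\times E_{\mathsf{A}_n}=\{(e_1,\dots,e_n): e_i\in E_{\mathsf{A}_i},\ r(e_i)=s(e_{i+1})\}$; its elements are written $e_1\cdots e_n$, with $s(e_1\cdots e_n)=s(e_1)$ and $r(e_1\cdots e_n)=r(e_n)$. $E_{\mathsf{A}}^n$ is the $n$-fold fibered product of $E_{\mathsf{A}}$ with itself, and iterated fibered products are identified via concatenation (e.g. $E_{\mathsf{A}}\times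 E_{\mathsf{A}}^m=E_{\mathsf{A}}^{m+1}=E_{\mathsf{A}}^m\times E_{\mathsf{A}}$). A path isomorphism is a bijection between two fibered products that preserves $s$ and $r$. Products $\times$ of path isomorphisms act on concatenations piecewise; $\mathrm{id}_{\mathsf{F}}$ is the identity of $E_{\mathsf{F}}$ and $\mathrm{id}_{\mathsf{A}^k}$ the identity of $E_{\mathsf{A}}^k$. Let $\mathsf{A}$ be $V\times V$, $\mathsf{B}$ be $W\times W$, with entries in $\mathbb{N}$. A concrete shift between $\mathsf{A}$ and $\mathsf{B}$ with lag $m$ is a tuple $(\mathsf{R},\mathsf{S},\varphi_{\mathsf{R}},\varphi_{\mathsf{S}},\psi_{\mathsf{A}},\psi_{\mathsf{B}})$ where $\mathsf{R}$ is a $V\times W$ matrix and $\mathsf{S}$ a $W\times V$ matrix, both with entries in $\mathbb{N}$, and $\varphi_{\mathsf{R}}:E_{\mathsf{A}}\times E_{\mathsf{R}}\to E_{\mathsf{R}}\times E_{\mathsf{B}}$, $\varphi_{\mathsf{S}}:E_{\mathsf{B}}\times E_{\mathsf{S}}\to E_{\mathsf{S}}\times E_{\mathsf{A}}$, $\psi_{\mathsf{A}}:E_{\mathsf{R}}\times E_{\mathsf{S}}\to E_{\mathsf{A}}^m$, $\psi_{\mathsf{B}}:E_{\mathsf{S}}\times E_{\mathsf{R}}\to E_{\mathsf{B}}^m$ are path isomorphisms. Define $\varphi_{\mathsf{R}}^{(m)}:E_{\mathsf{A}}^m\times E_{\mathsf{R}}\to E_{\mathsf{R}}\times E_{\mathsf{B}}^m$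 by $\varphi_{\mathsf{R}}^{(m)}=(\varphi_{\mathsf{R}}\times\mathrm{id}_{\mathsf{B}^{m-1}})(\mathrm{id}_{\mathsf{A}}\times\varphi_{\mathsf{R}}\times\mathrm{id}_{\mathsf{B}^{m-2}})\cdots(\mathrm{id}_{\mathsf{A}^{m-1}}\times\varphi_{\mathsf{R}})$, and $\varphi_{\mathsf{S}}^{(m)}:E_{\mathsf{B}}^m\times E_{\mathsf{S}}\to E_{\mathsf{S}}\times E_{\mathsf{A}}^m$ analogously. The concrete shift is: - aligned if $(\psi_{\mathsf{A}}\times\mathrm{id}_{\mathsf{A}})(\mathrm{id}_{\mathsf{R}}\times\varphi_{\mathsf{S}})(\varphi_{\mathsf{R}}\times\mathrm{id}_{\mathsf{S}})=\mathrm{id}_{\mathsf{A}}\times\psi_{\mathsf{A}}$ and $(\psi_{\mathsf{B}}\times\mathrm{id}_{\mathsf{B}})(\mathrm{id}_{\mathsf{S}}\times\varphi_{\mathsf{R}})(\varphi_{\mathsf{S}}\times\mathrm{id}_{\mathsf{R}})=\mathrm{id}_{\mathsf{B}}\times\psi_{\mathsf{B}}$; - balanced if $\psi_{\mathsf{A}}^{-1}\times\psi_{\mathsf{A}}=(\mathrm{id}_{\mathsf{R}}\times\varphi_{\mathsf{S}}^{(m)})(\varphi_{\mathsf{R}}^{(m)}\times\mathrm{id}_{\mathsf{S}})$ and $\psi_{\mathsf{B}}^{-1}\times\psi_{\mathsf{B}}=(\mathrm{id}_{\mathsf{S}}\times\varphi_{\mathsf{R}}^{(m)})(\varphi_{\mathsf{S}}^{(m)}\times\mathrm{id}_{\mathsf{R}})$;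 - compatible if $\varphi_{\mathsf{R}}^{(m)}=(\mathrm{id}_{\mathsf{R}}\times\psi_{\mathsf{B}})(\psi_{\mathsf{A}}^{-1}\times\mathrm{id}_{\mathsf{R}})$ and $\varphi_{\mathsf{S}}^{(m)}=(\mathrm{id}_{\mathsf{S}}\times\psi_{\mathsf{A}})(\psi_{\mathsf{B}}^{-1}\times\mathrm{id}_{\mathsf{S}})$. $\mathsf{A}$ and $\mathsf{B}$ are aligned (resp. balanced, compatible) shift related with lag $m$ if there is a concrete shift between them with lag $m$ that is aligned (resp. balanced, compatible). $\mathsf{A}$ and $\mathsf{B}$ are strong shift equivalent with lag $n$ if there are finite rectangular matrices $\mathsf{R}_1,\dots,\mathsf{R}_n,\mathsf{S}_1,\dots,\mathsf{S}_n$ with entries in $\mathbb{N}$ with $\mathsf{A}=\mathsf{R}_1\mathsf{S}_1$, $\mathsf{S}_n\mathsf{R}_n=\mathsf{B}$ and $\mathsf{S}_i\mathsf{R}_i=\mathsf{R}_{i+1}\mathsf{S}_{i+1}$ for $i=1,\dots,n-1$; strong shift equivalent means this for some $n\ge1$. *)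

(* Defs.v *)
From mathcomp Require Import all_boot.

Set Implicit Arguments.
Unset Strict Implicit.
Unset Printing Implicit Defensive.

(** Plain functions rather than ['M[nat]_(m, n)], so that rows and columns are
    indexed by arbitrary finite sets. *)
Definition natmx (V W : finType) := V -> W -> nat.

Definition natmx_mul (V W U : finType) (R : natmx V W) (S : natmx W U) :
  natmx V U := fun v u => \sum_(w : W) R v w * S w u.

Definition essential (V W : finType) (F : natmx V W) : Prop :=
  (forall v, exists w, F v w <> 0) /\ (forall w, exists v, F v w <> 0).

Record span (V W : Type) := Span {
  carrier :> Type;
  src : carrier -> V;
  rng : carrier -> W }.

Definition edges (V W : finType) (F : natmx V W) : span V W :=
  @Span V W {e : V * nat * W | e.1.2 < F e.1.1 e.2}
    (fun e => (val e).1.1) (fun e => (val e).2).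

Definition fibprod (V U W : finType) (X : span V U) (Y : span U W) : span V W :=
  @Span V W {xy : X * Y | rng xy.1 == src xy.2}
    (fun p => src (val p).1) (fun p => rng (val p).2).

Notation "X ** Y" := (fibprod X Y) (at level 40, left associativity).

Record piso (V W : Type) (X Y : span V W) := PIso {
  pfun :> X -> Y;
  pfun_inv : Y -> X;
  pfunK : cancel pfun pfun_inv;
  pfun_invK : cancel pfun_inv pfun;
  src_pfun : forall x, src (pfun x) = src x;
  rng_pfun : forall x, rng (pfun x) = rng x }.

Definition pid (V W : Type) (X : span V W) : piso X X :=
  @PIso V W X X id id (fun=> erefl) (fun=> erefl) (fun=> erefl) (fun=> erefl).

Section Inverse.
Variables (V W : Type) (X Y : span V W) (f : piso X Y).

Lemma src_pfun_inv y : src (pfun_inv f y) = src y.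
Proof. by rewrite -{2}(pfun_invK f y) src_pfun. Qed.

Lemma rng_pfun_inv y : rng (pfun_inv f y) = rng y.
Proof. by rewrite -{2}(pfun_invK f y) rng_pfun. Qed.

Definition pinv : piso Y X :=
  PIso (pfun_invK f) (pfunK f) src_pfun_inv rng_pfun_inv.
End Inverse.

Section Composition.
Variables (V W : Type) (X Y Z : span V W) (g : piso Y Z) (f : piso X Y).

Lemma src_pcomp x : src ((g \o f) x) = src x.
Proof. by rewrite /= !src_pfun. Qed.

Lemma rng_pcomp x : rng ((g \o f) x) = rng x.
Proof. by rewrite /= !rng_pfun. Qed.

Definition pcomp : piso X Z :=
  PIso (can_comp (pfunK g) (pfunK f)) (can_comp (pfun_invK f) (pfun_invK g))
    src_pcomp rng_pcomp.
End Composition.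

Notation "g \oP f" := (pcomp g f) (at level 50, left associativity).

Section Product.
Variables (V U W : finType).

Lemma pprod_subproof (X X' : span V U) (Y Y' : span U W)
    (f : piso X X') (g : piso Y Y') (p : X ** Y) :
  rng (f (val p).1) == src (g (val p).2).
Proof. by rewrite rng_pfun src_pfun (valP p). Qed.

Definition pprod_fun (X X' : span V U) (Y Y' : span U W)
    (f : piso X X') (g : piso Y Y') (p : X ** Y) : X' ** Y' :=
  exist _ (f (val p).1, g (val p).2) (pprod_subproof f g p).

Variables (X X' : span V U) (Y Y' : span U W) (f : piso X X') (g : piso Y Y').

Lemma pprod_funK : cancel (pprod_fun f g) (pprod_fun (pinv f) (pinv g)).
Proof. by case=> -[x y] h; apply: val_inj; rewrite /= !pfunK. Qed.

Lemma pprod_fun_invK : cancel (pprod_fun (pinv f) (pinv g)) (pprod_fun f g).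
Proof. by case=> -[x y] h; apply: val_inj; rewrite /= !pfun_invK. Qed.

Definition pprod : piso (X ** Y) (X' ** Y') :=
  @PIso V W (X ** Y) (X' ** Y') _ _ pprod_funK pprod_fun_invK
    (fun p => src_pfun f _) (fun p => rng_pfun g _).
End Product.

Notation "f *P g" := (pprod f g) (at level 40, left associativity).

(** The identification of iterated fibered products via concatenation is made
    explicit: [passoc] re-brackets, its inverse is [pinv (passoc _ _ _)]. *)
Section Associativity.
Variables (V U U' W : finType).
Variables (X : span V U) (Y : span U U') (Z : span U' W).

Definition passoc_fun (p : X ** Y ** Z) : X ** (Y ** Z) :=
  exist _ ((val (val p).1).1,
           exist _ ((val (val p).1).2, (val p).2) (valP p) : Y ** Z)
    (valP (val p).1).

Definition passoc_inv (p : X ** (Y ** Z)) : X ** Y ** Z :=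
  exist _ (exist _ ((val p).1, (val (val p).2).1) (valP p) : X ** Y,
           (val (val p).2).2)
    (valP (val p).2).

Lemma passoc_funK : cancel passoc_fun passoc_inv.
Proof.
case=> -[[[x y] h] z] h'; apply: val_inj.
by congr pair; apply: val_inj.
Qed.

Lemma passoc_invK : cancel passoc_inv passoc_fun.
Proof.
case=> -[x [[y z] h]] h'; apply: val_inj.
by congr pair; apply: val_inj.
Qed.

Definition passoc : piso (X ** Y ** Z) (X ** (Y ** Z)) :=
  @PIso V W (X ** Y ** Z) (X ** (Y ** Z)) _ _ passoc_funK passoc_invK
    (fun=> erefl) (fun=> erefl).
End Associativity.

Arguments passoc {V U U' W} X Y Z.
Arguments pid {V W} X.

(** [powS X k] is the [k.+1]-fold fibered product of [X] with itself, so the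
    [m]-fold one is [powS X m.-1] for [0 < m]. *)
Fixpoint powS (V : finType) (X : span V V) (k : nat) : span V V :=
  if k is k'.+1 then X ** powS X k' else X.

(** Concatenation identifies paths followed by one edge with one edge followed
    by paths. *)
Fixpoint psnoc (V : finType) (X : span V V) (k : nat) :
    piso (powS X k ** X) (X ** powS X k) :=
  match k with
  | 0 => pid (X ** X)
  | k'.+1 => (pid X *P psnoc X k') \oP passoc X (powS X k') X
  end.

(** [phi_pow phi k] is phi^(k.+1): phi^(1) = phi and
    phi^(k.+2) = (phi x id_{B^(k.+1)}) (id_A x phi^(k.+1)), which multiplies out
    to (phi x id) (id_A x phi x id) ... (id_{A^(k.+1)} x phi). *)
Fixpoint phi_pow (V W : finType) (X : span V V) (R : span V W) (Y : span W W)
    (phi : piso (X ** R) (R ** Y)) (k : nat) :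
    piso (powS X k ** R) (R ** powS Y k) :=
  match k with
  | 0 => phi
  | k'.+1 =>
      passoc R Y (powS Y k')
      \oP (phi *P pid (powS Y k'))
      \oP pinv (passoc X R (powS Y k'))
      \oP (pid X *P phi_pow phi k')
      \oP passoc X (powS X k') R
  end.

(** Only meaningful for a lag [0 < m], because of [m.-1]. *)
Record concrete_shift (V W : finType) (A : natmx V V) (B : natmx W W)
    (m : nat) := ConcreteShift {
  cs_R : natmx V W;
  cs_S : natmx W V;
  phiR : piso (edges A ** edges cs_R) (edges cs_R ** edges B);
  phiS : piso (edges B ** edges cs_S) (edges cs_S ** edges A);
  psiA : piso (edges cs_R ** edges cs_S) (powS (edges A) m.-1);
  psiB : piso (edges cs_S ** edges cs_R) (powS (edges B) m.-1) }.

(** Each predicate below is one of the two symmetric equations of the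
    corresponding condition, for arbitrary spans; the other one is obtained by
    exchanging the roles of (X, R) and (Y, S). *)
Section Conditions.
Variables (V W : finType) (X : span V V) (Y : span W W).
Variables (R : span V W) (S : span W V) (k : nat).
Variables (fR : piso (X ** R) (R ** Y)) (fS : piso (Y ** S) (S ** X)).
Variables (gX : piso (R ** S) (powS X k)) (gY : piso (S ** R) (powS Y k)).

Definition aligned_eq : Prop :=
  psnoc X k
    \oP (gX *P pid X)
    \oP pinv (passoc R S X)
    \oP (pid R *P fS)
    \oP passoc R Y S
    \oP (fR *P pid S)
    \oP pinv (passoc X R S)
  =1 pid X *P gX.

Definition balanced_eq : Prop :=
  pinv gX *P gX
  =1 pinv (passoc R S (powS X k))
       \oP (pid R *P phi_pow fS k)
       \oP passoc R (powS Y k) S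
       \oP (phi_pow fR k *P pid S)
       \oP pinv (passoc (powS X k) R S).

Definition compatible_eq : Prop :=
  phi_pow fR k
  =1 (pid R *P gY) \oP passoc R S R \oP (pinv gX *P pid R).
End Conditions.

Section ShiftRelations.
Variables (V W : finType) (A : natmx V V) (B : natmx W W) (m : nat).

Definition aligned (c : concrete_shift A B m) : Prop :=
  aligned_eq (phiR c) (phiS c) (psiA c) /\ aligned_eq (phiS c) (phiR c) (psiB c).

Definition balanced (c : concrete_shift A B m) : Prop :=
  balanced_eq (phiR c) (phiS c) (psiA c) /\
  balanced_eq (phiS c) (phiR c) (psiB c).

Definition compatible (c : concrete_shift A B m) : Prop :=
  compatible_eq (phiR c) (psiA c) (psiB c) /\
  compatible_eq (phiS c) (psiB c) (psiA c).

Definition aligned_shift_related : Prop :=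
  exists c : concrete_shift A B m, aligned c.

Definition balanced_shift_related : Prop :=
  exists c : concrete_shift A B m, balanced c.

Definition compatible_shift_related : Prop :=
  exists c : concrete_shift A B m, compatible c.
End ShiftRelations.

(** The recursion peels off the pair (R_1, S_1); the remaining pairs form a
    chain of length [n.-1] from S_1 R_1 to [B]. The lag is at least 1. *)
Fixpoint sse_lag (n : nat) (V W : finType) (A : natmx V V) (B : natmx W W) :
    Prop :=
  match n with
  | 0 => False
  | 1 => exists (R : natmx V W) (S : natmx W V),
           A =2 natmx_mul R S /\ natmx_mul S R =2 B
  | n'.+1 => exists (U : finType) (R : natmx V U) (S : natmx U V),
           A =2 natmx_mul R S /\ sse_lag n' (natmx_mul S R) B
  end.

Definition strong_shift_equivalent (V W : finType) (A : natmx V V)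
    (B : natmx W W) : Prop := exists2 n, 0 < n & sse_lag n A B.

(* Main.v *)
Require Import Defs.
From mathcomp Require Import all_boot.

(** Write a path of A as a_1 a_2 ... and let r_i s_i be the preimage of
    a_i ... a_(i+m-1) under psi_A.

    Aligned implies balanced: iterating the aligned equation m times gives
    (psi_A x id) (id x phi_S^(m)) (phi_R^(m) x id) = id x psi_A on paths of
    length m, which is the balanced equation.

    Balanced implies compatible, after replacing psi_B: in
    phi_R^(m)(psi_A(r' s') r) = r' q the path q does not depend on r', because
    phi_S^(m)(q s) = s' psi_A(r s). Take psi_B(s' r) = q.

    Compatible implies aligned: extend a path of length m + 1 to an infinite one.
    Comparing overlapping windows, compatibility forces
    phi_R(a_i r_(i+1)) = r_i b_i with b_i ... b_(i+m-1) = psi_B(s_i r_(i+m)), then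
    phi_S(b_i s_(i+1)) = s_i c_i, and finally c_i = a_(i+m).

    Compatible implies strong shift equivalent: phi_R makes E_R the vertex set of
    a graph, each pair a r = r' b being an edge from r' to r. Compatibility says
    that the first end of a lift of a path of length m of A depends on the path
    only, so merging vertices that paths of length k = 0, ..., m cannot tell apart
    leads from this graph to A by elementary equivalences; reversing the arrows
    gives the same for B.

    Strong shift equivalent implies aligned: an elementary equivalence is an
    aligned shift of lag 1, and it can be composed with an aligned shift of lag n
    to give one of lag n + 1 with matrices R R' and S' S. *)

Set Implicit Arguments.
Unset Strict Implicit.
Unset Printing Implicit Defensive.

(** * Paths and graphs of path isomorphisms *)

Section Paths.
Variables (V : finType) (X : span V V).

Fixpoint path_seq k : powS X k -> seq X :=
  match k with
  | 0 => fun x => [:: x]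
  | k'.+1 => fun p => (val p).1 :: path_seq (val p).2
  end.

Fixpoint walk (v : V) (p : seq X) (w : V) : Prop :=
  if p is a :: p' then src a = v /\ walk (rng a) p' w else v = w.

Lemma size_path_seq k (p : powS X k) : size (path_seq p) = k.+1.
Proof. by elim: k p => //= k IH p; rewrite IH. Qed.

Lemma walk_path_seq k (p : powS X k) : walk (src p) (path_seq p) (rng p).
Proof.
elim: k p => [|k IH] //= [[a p] h] /=; split=> //.
by rewrite (eqP h); apply: IH.
Qed.

Lemma walk_cat v p q w :
  walk v (p ++ q) w <-> exists2 u, walk v p u & walk u q w.
Proof.
elim: p v => [|a p IH] v /=; first by split=> [|[u ->]] //; exists v.
split=> [[ha /IH[u hp hq]]|[u [ha hp] hq]]; first by exists u.
by split=> //; apply/IH; exists u.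
Qed.

Lemma path_seq_inj k : injective (@path_seq k).
Proof.
elim: k => [|k IH] /= x y; first by case.
case: x y => [[a p] h] [[b q] h'] /= [eab /IH epq].
by apply: val_inj; rewrite /= eab epq.
Qed.

(** Existence is stated with [sig], as for [mv_total] or [cut_onto], so that witnesses for
    infinitely many indices form a sequence without a choice axiom. *)
Lemma path_seq_surj k v l w : walk v l w -> size l = k.+1 ->
  {p : powS X k | path_seq p = l & src p = v /\ rng p = w}.
Proof.
elim: k v l => [|k IH] v [|a l] //=.
  by case: l => //= -[? ?] _; exists a.
case=> ha /IH {}IH [/IH[p ep [sp rp]]].
have h : rng a == src p by rewrite sp.
by exists (exist _ (a, p) h) => //=; rewrite ep.
Qed.

Lemma pow_of_size k v l w : walk v l w -> size l = k.+1 ->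
  {p : powS X k | path_seq p = l}.
Proof. by move=> h /(path_seq_surj h) [p]; exists p. Qed.

Lemma path_seq_psnoc k (p : powS X k ** X) :
  path_seq (psnoc X k p : powS X k.+1) = rcons (path_seq (val p).1) (val p).2.
Proof.
elim: k p => [|k IH] //=; case=> -[x a] h //=.
by congr cons; apply: IH.
Qed.

(** Positive length matters: the empty walk sits at every vertex. *)
Lemma walk_ends v v' p w w' n : walk v p w -> walk v' p w' -> size p = n.+1 ->
  v = v' /\ w = w'.
Proof.
case: p => //= a p [<- h] [<- h'] _; split=> //.
by elim: p (rng a) h h' => [|b p IH] u /=;
  [move=> <- | case=> _ h [_ /(IH _ h)]].
Qed.

End Paths.

Section Relations.

(** The graphs of the path isomorphisms phi ([mv]) and psi ([cut]). Working with
    them instead of with the functions removes all bracketing of products, and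
    powers of [X] become sequences. *)
Definition mv (V U U' W : finType) (X : span V U) (R : span U W)
    (R' : span V U') (Y : span U' W) (f : piso (X ** R) (R' ** Y)) a r r' b :=
  exists2 p, val p = (a, r) & val (f p) = (r', b).

Definition cut (V W : finType) (X : span V V) (R : span V W) (S : span W V) k
    (g : piso (R ** S) (powS X k)) r s l :=
  exists2 p, val p = (r, s) & path_seq (g p) = l.

Section Mv.
Variables (V U U' W : finType) (X : span V U) (R : span U W).
Variables (R' : span V U') (Y : span U' W) (f : piso (X ** R) (R' ** Y)).

Lemma mv_total a r : rng a = src r -> {y | mv f a r y.1 y.2}.
Proof.
move=> /eqP h; exists (val (f (exist _ (a, r) h))).
by exists (exist _ (a, r) h) => //; case: (val _).
Qed.

Lemma mv_onto r b : rng r = src b -> {y | mv f y.1 y.2 r b}.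
Proof.
move=> /eqP h; exists (val (pfun_inv f (exist _ (r, b) h))).
exists (pfun_inv f (exist _ (r, b) h)); first by case: (val _).
by rewrite pfun_invK.
Qed.

Lemma mv_fun a r r1 b1 r2 b2 :
  mv f a r r1 b1 -> mv f a r r2 b2 -> r1 = r2 /\ b1 = b2.
Proof.
move=> [p hp hf] [p' hp' hf'].
have e : p = p' by apply: val_inj; rewrite hp hp'.
by move: hf'; rewrite -e hf => -[-> ->].
Qed.

Lemma mv_inj a1 r1 a2 r2 r b :
  mv f a1 r1 r b -> mv f a2 r2 r b -> a1 = a2 /\ r1 = r2.
Proof.
move=> [p hp hf] [p' hp' hf'].
have e : p = p'.
  by apply: (can_inj (pfunK f)); apply: val_inj; rewrite hf hf'.
by move: hp'; rewrite -e hp => -[-> ->].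
Qed.

Lemma mv_ends a r r' b : mv f a r r' b ->
  [/\ rng a = src r, rng r' = src b, src r' = src a & rng b = rng r].
Proof.
move=> [p hp hf].
have:= valP p; have:= valP (f p); have:= src_pfun f p; have:= rng_pfun f p.
by rewrite /= hp hf /= => -> -> /eqP -> /eqP ->.
Qed.

End Mv.

Section Cut.
Variables (V W : finType) (X : span V V) (R : span V W) (S : span W V).
Variable k : nat.
Variable (g : piso (R ** S) (powS X k)).

Lemma cut_total r s : rng r = src s -> {l | cut g r s l}.
Proof.
move=> /eqP h; exists (path_seq (g (exist _ (r, s) h))).
by exists (exist _ (r, s) h).
Qed.

Lemma cut_onto v l w : walk v l w -> size l = k.+1 -> {y | cut g y.1 y.2 l}.
Proof.
move=> hw /(path_seq_surj hw) [p hp _].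
exists (val (pfun_inv g p)); exists (pfun_inv g p); first by case: (val _).
by rewrite pfun_invK.
Qed.

Lemma cut_fun r s l1 l2 : cut g r s l1 -> cut g r s l2 -> l1 = l2.
Proof.
move=> [p hp hf] [p' hp' hf'].
have e : p = p' by apply: val_inj; rewrite hp hp'.
by rewrite -hf e.
Qed.

Lemma cut_inj r1 s1 r2 s2 l : cut g r1 s1 l -> cut g r2 s2 l ->
  r1 = r2 /\ s1 = s2.
Proof.
move=> [p hp hf] [p' hp' hf'].
have e : p = p'.
  apply: (can_inj (pfunK g)); apply: path_seq_inj; by rewrite hf hf'.
by move: hp'; rewrite -e hp => -[-> ->].
Qed.

Lemma cut_ends r s l : cut g r s l ->
  [/\ rng r = src s, walk (src r) l (rng s) & size l = k.+1].
Proof.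
move=> [p hp hf].
have:= valP p; have:= src_pfun g p; have:= rng_pfun g p.
have:= walk_path_seq (g p); have:= size_path_seq (g p).
by rewrite /= hp hf /= => -> ? <- <- /eqP ->.
Qed.

Lemma cut_path_seq r s (p : powS X k) :
  cut g r s (path_seq p) <-> val (pfun_inv g p) = (r, s).
Proof.
split=> [[x <- /path_seq_inj <-]|h]; first by rewrite pfunK.
by exists (pfun_inv g p); rewrite ?pfun_invK.
Qed.

End Cut.

Section Moves.
Variables (V W : finType) (X : span V V) (R : span V W) (Y : span W W).
Variable (f : piso (X ** R) (R ** Y)).

(** The graph of phi^(n) for every n, 0 included: [r] is carried leftwards through [p] and leaves as
    [r'], turning [p] into [q]. *)
Fixpoint mvs (p : seq X) (r r' : R) (q : seq Y) : Prop :=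
  match p, q with
  | [::], [::] => r = r'
  | a :: p', b :: q' => exists2 r1, mvs p' r r1 q' & mv f a r1 r' b
  | _, _ => False
  end.

Lemma mvs_size p r r' q : mvs p r r' q -> size p = size q.
Proof. by elim: p q r' => [|a p IH] [|b q] r' //= [r1 /IH->]. Qed.

Lemma mvs_total v p r : walk v p (src r) ->
  {y | mvs p r y.1 y.2 & src y.1 = v}.
Proof.
elim: p v => [|a p IH] v /=; first by move=> ->; exists (r, [::]).
case=> <- /IH [[r1 q] /= h1 e1].
have [[r' b] h] := mv_total f (esym e1).
by exists (r', b :: q); [exists r1 | have [] := mv_ends h].
Qed.

Lemma mvs_onto q r' w : walk (rng r') q w -> {y | mvs y.1 y.2 r' q}.
Proof.
elim: q r' => [|b q IH] r' /=; first by exists ([::], r').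
move=> [e hq]; have [[a r1] /= h] := mv_onto f (esym e).
have [_ _ _ e1] := mv_ends h; rewrite e1 in hq.
by have [[p r] /= h'] := IH _ hq; exists (a :: p, r), r1.
Qed.

Lemma mvs_fun p r r1 q1 r2 q2 :
  mvs p r r1 q1 -> mvs p r r2 q2 -> r1 = r2 /\ q1 = q2.
Proof.
elim: p r1 q1 r2 q2 => [|a p IH] r1 [|b1 q1] r2 [|b2 q2] //=.
  by move=> -> ->.
move=> [r3 /IH h1 h2] [r4 /h1 [<- <-] h4].
by have [-> ->] := mv_fun h2 h4.
Qed.

Lemma mvs_inj q p1 r1 p2 r2 r :
  mvs p1 r1 r q -> mvs p2 r2 r q -> p1 = p2 /\ r1 = r2.
Proof.
elim: q p1 p2 r => [|b q IH] [|a1 p1] [|a2 p2] r //=; first by move=> -> ->.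
move=> [r3 h1 h2] [r4 h3 h4].
have [e1 e2] := mv_inj h2 h4; rewrite -e2 in h3.
by have [-> ->] := IH _ _ _ h1 h3; rewrite e1.
Qed.

Lemma mvs_ends p r r' q : mvs p r r' q ->
  walk (src r') p (src r) /\ walk (rng r') q (rng r).
Proof.
elim: p q r' => [|a p IH] [|b q] r' //=; first by move=> ->.
move=> [r1 /IH[h1 h2] /mv_ends[-> -> -> ->]].
by do !split.
Qed.

Lemma mvs_cat p1 p2 r r' q1 q2 : size p1 = size q1 ->
  mvs (p1 ++ p2) r r' (q1 ++ q2) <->
  exists2 r1, mvs p2 r r1 q2 & mvs p1 r1 r' q1.
Proof.
elim: p1 q1 r' => [|a p1 IH] [|b q1] r' //=.
  by split=> [h|[r1 h <-]] //; exists r'.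
case=> /IH {}IH; split=> [[r1 /IH[r2 h2 h1] h]|[r1 h1 [r2 h2 h]]].
  by exists r2 => //; exists r1.
by exists r2 => //; apply/IH; exists r1.
Qed.

Lemma mvs_phi_pow k (x : powS X k ** R) :
  mvs (path_seq (val x).1) (val x).2
    (val (phi_pow f k x)).1 (path_seq (val (phi_pow f k x)).2).
Proof.
elim: k x => [|k IH] x.
  exists (val x).2 => //; exists x; first by case: (val x).
  by case: (val (phi_pow _ _ _)).
pose y := passoc X (powS X k) R x.
exists (val (phi_pow f k (val y).2)).1; first exact: IH (val y).2.
pose z := pinv (passoc X R (powS Y k)) ((pid X *P phi_pow f k) y).
by exists (val z).1; last exact: surjective_pairing.
Qed.

Lemma phi_powP k (x : powS X k ** R) r' q :
  mvs (path_seq (val x).1) (val x).2 r' (path_seq q) <->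
  val (phi_pow f k x) = (r', q).
Proof.
split=> [/(mvs_fun (mvs_phi_pow x))[<- /path_seq_inj <-]|h].
  by case: (val _).
by have:= mvs_phi_pow x; rewrite h.
Qed.

Lemma mv_phi_pow k (p : powS X k) r r' (q : powS Y k) :
  mv (phi_pow f k) p r r' q <-> mvs (path_seq p) r r' (path_seq q).
Proof.
split=> [[x hx /phi_powP]|h]; first by rewrite hx.
have [e1 e2] := mvs_ends h.
have e : rng p == src r.
  by have [_ ->] := walk_ends (walk_path_seq p) e1 (size_path_seq p).
by exists (exist _ (p, r) e) => //; apply/phi_powP.
Qed.

End Moves.
End Relations.

(** * Triple fibered products up to re-bracketing *)

Section Triples.
Variables (V U U' W : finType).
Variables (X : span V U) (Y : span U U') (Z : span U' W).

(** Both bracketings are described by the same three components, so that [passoc] leaves the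
    description unchanged. *)
Definition tripl (x : X ** Y ** Z) a b c :=
  val (val x).1 = (a, b) /\ (val x).2 = c.
Definition tripr (x : X ** (Y ** Z)) a b c :=
  (val x).1 = a /\ val (val x).2 = (b, c).

Lemma tripr_surj x : {y : X * Y * Z | tripr x y.1.1 y.1.2 y.2}.
Proof.
exists ((val x).1, (val (val x).2).1, (val (val x).2).2).
by split=> //; case: (val _).
Qed.

Lemma tripr_exists a b c : rng a = src b -> rng b = src c ->
  {x | tripr x a b c}.
Proof.
move=> /eqP h /eqP h'.
by exists (exist _ (a, exist _ (b, c) h' : Y ** Z) h).
Qed.

Lemma tripl_inj x a b c y : tripl x a b c -> tripl y a b c -> x = y.
Proof.
move=> [e0 e1] [e2 e3]; apply: val_inj.
rewrite [LHS]surjective_pairing [RHS]surjective_pairing e1 e3.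
by congr pair; apply: val_inj; rewrite e0 e2.
Qed.

Lemma tripr_ends x a b c : tripr x a b c -> rng a = src b /\ rng b = src c.
Proof.
move=> [<- h]; have /eqP := valP x; have /eqP := valP (val x).2.
by rewrite /= h => -> ->.
Qed.

Lemma tripr_passoc x a b c : tripl x a b c -> tripr (passoc X Y Z x) a b c.
Proof. by move=> [h <-]; split; rewrite /= h. Qed.

Lemma tripl_passoc x a b c :
  tripr x a b c -> tripl (pinv (passoc X Y Z) x) a b c.
Proof. by move=> [<- h]; split; rewrite /= h. Qed.
End Triples.

Section TriplesMv.
Variables (V U U' W T : finType).

Lemma tripl_pprod (X : span V U) (Y : span U U') (Z : span U' W)
    (X' : span V T) (Y' : span T U')
    (f : piso (X ** Y) (X' ** Y')) x a b c a' b' :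
  tripl x a b c -> mv f a b a' b' -> tripl ((f *P pid Z) x) a' b' c.
Proof.
move=> [h <-] [p hp hf]; split=> //=.
by rewrite (_ : (val x).1 = p) //; apply: val_inj; rewrite h hp.
Qed.

Lemma tripr_pprod (X : span V U) (Y : span U U') (Z : span U' W)
    (Y' : span U T) (Z' : span T W)
    (f : piso (Y ** Z) (Y' ** Z')) x a b c b' c' :
  tripr x a b c -> mv f b c b' c' -> tripr ((pid X *P f) x) a b' c'.
Proof.
move=> [<- h] [p hp hf]; split=> //=.
by rewrite (_ : (val x).2 = p) //; apply: val_inj; rewrite h hp.
Qed.
End TriplesMv.

(** * The three conditions in terms of graphs *)

Section ConditionsAsRelations.
Variables (V W : finType) (X : span V V) (Y : span W W).
Variables (R : span V W) (S : span W V) (k : nat).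
Variables (fR : piso (X ** R) (R ** Y)) (fS : piso (Y ** S) (S ** X)).
Variables (gX : piso (R ** S) (powS X k)) (gY : piso (S ** R) (powS Y k)).

Lemma alignedP : aligned_eq fR fS gX <->
  forall a r2 r1 b s2 s1 a' l, mv fR a r2 r1 b -> mv fS b s2 s1 a' ->
    cut gX r2 s2 l -> exists2 l', cut gX r1 s1 l' & rcons l' a' = a :: l.
Proof.
(* An equivalence at a single triple [t] serves both directions. *)
have key t a r2 r1 b s2 s1 a' l l' :
    tripr t a r2 s2 -> mv fR a r2 r1 b -> mv fS b s2 s1 a' ->
    cut gX r2 s2 l -> cut gX r1 s1 l' ->
    rcons l' a' = a :: l <->
    (psnoc X k \oP (gX *P pid X) \oP pinv (passoc R S X) \oP (pid R *P fS)
      \oP passoc R Y S \oP (fR *P pid S) \oP pinv (passoc X R S)) t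
    = (pid X *P gX) t.
  move=> ht h1 h2 [x hx <-] [y hy <-].
  have := tripl_passoc (tripr_pprod (tripr_passoc (tripl_pprod
    (tripl_passoc ht) h1)) h2).
  set z := (Z in tripl Z _ _ _) => -[hz1 hz2].
  rewrite -[Z in _ <-> Z]/(psnoc X k ((gX *P pid X) z) = _); clearbody z.
  have -> : rcons (path_seq (gX y)) a' =
      path_seq (psnoc X k ((gX *P pid X) z) : powS X k.+1).
    by rewrite path_seq_psnoc /= hz2 (_ : (val z).1 = y) //; apply: val_inj;
       rewrite hz1 hy.
  have -> : a :: path_seq (gX x) = path_seq ((pid X *P gX) t : powS X k.+1).
    rewrite /=; case: ht => -> hx'.
    by rewrite (_ : (val t).2 = x) //; apply: val_inj; rewrite hx hx'.
  by split=> [/path_seq_inj|->].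
split=> [E a r2 r1 b s2 s1 a' l h1 h2 h3|E t].
  have [e1 e2 e3 e4] := mv_ends h1; have [e5 e6 e7 e8] := mv_ends h2.
  have [t ht] : {t | tripr (X := X) (Y := R) (Z := S) t a r2 s2}.
    by apply: tripr_exists => //; rewrite -e5 e4.
  have [l' hl'] : {l | cut gX r1 s1 l} by apply: cut_total; rewrite e7 e2.
  by exists l' => //; apply/(key _ _ _ _ _ _ _ _ _ _ ht h1 h2 h3 hl'); apply: E.
have [[[a r2] s2] /= ht] := tripr_surj t.
have [e1 e2] := tripr_ends ht.
have [[r1 b] /= h1] := mv_total fR e1; have [_ e3 e4 e5] := mv_ends h1.
have [|[s1 a'] /= h2] := @mv_total _ _ _ _ _ _ _ _ fS b s2; first by rewrite e5.
have [l h3] := cut_total gX e2.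
have [l' hl' el'] := E _ _ _ _ _ _ _ _ h1 h2 h3.
by apply/(key _ _ _ _ _ _ _ _ _ _ ht h1 h2 h3 hl').
Qed.

Lemma balancedP : balanced_eq fR fS gX <->
  forall p r r' q s s' p', size p = k.+1 ->
    mvs fR p r r' q -> mvs fS q s s' p' -> cut gX r' s' p /\ cut gX r s p'.
Proof.
have key t p r r' q s s' p' :
    tripr t p r s -> mv (phi_pow fR k) p r r' q ->
    mv (phi_pow fS k) q s s' p' ->
    cut gX r' s' (path_seq p) /\ cut gX r s (path_seq p') <->
    (pinv gX *P gX) t =
    (pinv (passoc R S (powS X k)) \oP (pid R *P phi_pow fS k)
       \oP passoc R (powS Y k) S \oP (phi_pow fR k *P pid S)
       \oP pinv (passoc (powS X k) R S)) t.
  move=> ht h1 h2.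
  have := tripl_passoc (tripr_pprod (tripr_passoc (tripl_pprod
    (tripl_passoc ht) h1)) h2).
  set z := (Z in tripl Z _ _ _) => hz.
  rewrite -[Z in _ <-> Z]/((pinv gX *P gX) t = z); clearbody z.
  case: ht => ht1 ht2.
  split=> [[/cut_path_seq e1 [x hx /path_seq_inj e2]]|e].
    apply: tripl_inj hz; split; rewrite /= ?ht1 //.
    by rewrite (_ : (val t).2 = x) //; apply: val_inj; rewrite hx ht2.
  case: hz; rewrite -e /= ht1 => /cut_path_seq h <-; split=> //.
  by exists (val t).2.
split=> [E p r r' q s s' p' hp h1 h2|E t].
  have [e1 e2] := mvs_ends h1; have [e3 e4] := mvs_ends h2.
  have [P eP] := pow_of_size e1 hp.
  have sq := etrans (esym (mvs_size h1)) hp.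
  have [Q eQ] := pow_of_size e2 sq.
  have [P' eP'] := pow_of_size e4 (etrans (esym (mvs_size h2)) sq).
  rewrite -eP -eQ in h1; rewrite -eQ -eP' in h2; rewrite -eP -eP'.
  move/mv_phi_pow in h1; move/mv_phi_pow in h2.
  have [e5 _ _ e6] := mv_ends h1; have [e7 _ _ _] := mv_ends h2.
  have [t ht] : {t | tripr (X := powS X k) (Y := R) (Z := S) t P r s}.
    by apply: tripr_exists => //; rewrite -e6.
  by apply/(key _ _ _ _ _ _ _ _ ht h1 h2); apply: E.
have [[[p r] s] /= ht] := tripr_surj t.
have [e1 e2] := tripr_ends ht.
have [[r' q] /= h1] := mv_total (phi_pow fR k) e1.
have [_ e3 e4 e5] := mv_ends h1.
have [|[s' p'] /= h2] := @mv_total _ _ _ _ _ _ _ _ (phi_pow fS k) q s.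
  by rewrite e5.
apply/(key _ _ _ _ _ _ _ _ ht h1 h2).
move/mv_phi_pow in h1; move/mv_phi_pow in h2.
by apply: E h1 h2; rewrite size_path_seq.
Qed.

Lemma compatibleP : compatible_eq fR gX gY <->
  forall p r r' q, size p = k.+1 -> mvs fR p r r' q ->
    exists2 s, cut gX r' s p & cut gY s r q.
Proof.
have key x p r r' q : val x = (p, r) -> val (phi_pow fR k x) = (r', q) ->
    (exists2 s, cut gX r' s (path_seq p) & cut gY s r (path_seq q)) <->
    phi_pow fR k x =
    ((pid R *P gY) \oP passoc R S R \oP (pinv gX *P pid R)) x.
  move=> hx hy.
  set z := (passoc R S R) ((pinv gX *P pid R) x).
  rewrite -[Z in _ <-> Z]/(phi_pow fR k x = (pid R *P gY) z).
  have : tripr z (val (pfun_inv gX p)).1 (val (pfun_inv gX p)).2 r.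
    by apply: tripr_passoc; split; rewrite /= hx //; case: (val _).
  clearbody z => -[hz1 hz2].
  split=> [[s /cut_path_seq e1 [y ey /path_seq_inj eY]]|e].
    apply: val_inj; rewrite hy /= hz1 e1 /= -eY.
    by congr (_, gY _); apply: val_inj; rewrite ey [RHS]hz2 e1.
  move: hy; rewrite e /= hz1 => -[e1 e2].
  exists (val (pfun_inv gX p)).2.
    by apply/cut_path_seq; rewrite -e1; apply: surjective_pairing.
  by exists (val z).2; rewrite ?e2.
split=> [E p r r' q hp h|E x].
  have [e1 e2] := mvs_ends h.
  have [P eP] := pow_of_size e1 hp.
  have [Q eQ] := pow_of_size e2 (etrans (esym (mvs_size h)) hp).
  rewrite -eP -eQ in h *.
  have /mv_phi_pow [x hx hy] := h.
  by apply/(key _ _ _ _ _ hx hy); apply: E.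
have hx := surjective_pairing (val x).
have hy := surjective_pairing (val (phi_pow fR k x)).
apply/(key _ _ _ _ _ hx hy); apply: E; first by rewrite size_path_seq.
exact: mvs_phi_pow.
Qed.
End ConditionsAsRelations.

(** * Aligned, balanced and compatible shifts with a given lag *)

(** The two totality hypotheses carry witnesses, which provide the map and its inverse. *)
Lemma piso_of_graph (T U : Type) (P Q : span T U) (G : P -> Q -> Prop) :
  (forall x, {y | G x y}) -> (forall y, {x | G x y}) ->
  (forall x y1 y2, G x y1 -> G x y2 -> y1 = y2) ->
  (forall x1 x2 y, G x1 y -> G x2 y -> x1 = x2) ->
  (forall x y, G x y -> src y = src x /\ rng y = rng x) ->
  {f : piso P Q | forall x, G x (f x)}.
Proof.
move=> tot onto fn inj ends.
pose F x := sval (tot x); pose F' y := sval (onto y).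
have GF x : G x (F x) := svalP (tot x).
have GF' y : G (F' y) y := svalP (onto y).
have FK : cancel F F' by move=> x; apply: inj (GF' _) (GF _).
have F'K : cancel F' F by move=> y; apply: fn (GF _) (GF' _).
by exists (PIso FK F'K (fun x => (ends _ _ (GF x)).1)
  (fun x => (ends _ _ (GF x)).2)).
Qed.

Section Implications.
Variables (V W : finType) (X : span V V) (Y : span W W).
Variables (R : span V W) (S : span W V) (k : nat).
Variables (fR : piso (X ** R) (R ** Y)) (fS : piso (Y ** S) (S ** X)).
Variables (gX : piso (R ** S) (powS X k)).

(** Each edge of [p], from the last to the first, costs one use of the aligned equation. *)
Lemma aligned_mvs p r2 r1 q s2 s1 p' t : aligned_eq fR fS gX ->
  mvs fR p r2 r1 q -> mvs fS q s2 s1 p' -> cut gX r2 s2 t ->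
  exists2 t', cut gX r1 s1 t' & t' ++ p' = p ++ t.
Proof.
move=> /alignedP al.
elim: p q p' r1 s1 => [|a p IH] [|b q] [|a' p'] //= r1 s1.
  by move=> <- <- ht; exists t => //; rewrite cats0.
move=> [r3 hp ha] [s3 hq hb] /(IH _ _ _ _ hp hq)[t' ht' et'].
have [l hl el] := al _ _ _ _ _ _ _ _ ha hb ht'.
by exists l => //; rewrite -et' -cat_rcons el.
Qed.

Lemma aligned_balanced : aligned_eq fR fS gX -> balanced_eq fR fS gX.
Proof.
move=> al; apply/balancedP => p r r' q s s' p' sp h1 h2.
have e : rng r = src s.
  by have [_ e1] := mvs_ends h1; have [e2 _] := mvs_ends h2;
     have [] := walk_ends e1 e2 (etrans (esym (mvs_size h1)) sp).
have [t ht] := cut_total gX e.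
have [t' ht' e'] := aligned_mvs al h1 h2 ht.
have [_ _ st'] := cut_ends ht'.
(* Both [t'] and [p] have length [k.+1], so the equation splits into [t' = p] and [p' = t]. *)
have := congr1 (take k.+1) e'; have := congr1 (drop k.+1) e'.
by rewrite !take_size_cat // !drop_size_cat // => -> <-.
Qed.

(** The graph of the map sending [s' r] to the [q] with
    phiR^(m)(psiX(r' s') r) = r' q for all r'. *)
Definition middle (s' : S) (r : R) (q : seq Y) :=
  size q = k.+1 /\ forall r' p, cut gX r' s' p -> mvs fR p r r' q.

Section Middle.
Hypothesis bal : balanced_eq fR fS gX.
Hypothesis outS : forall w, {s : S | src s = w}.
Hypothesis inR : forall w, {r : R | rng r = w}.

(** In phiS^(m)(q s) = s' psiX(r s) the right-hand side does not involve [r'], and phiS^(m) is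
    injective. *)
Lemma middle_total s' r : rng s' = src r -> {q | middle s' r q}.
Proof.
have /balancedP balE := bal; move=> e.
have [r' er'] := inR (src s').
have [p hp] := cut_total gX er'.
have [_ wp sp] := cut_ends hp; rewrite e in wp.
have [s es] := outS (rng r).
have key r1 p1 : cut gX r1 s' p1 ->
  exists2 q1, mvs fR p1 r r1 q1 &
  exists2 p2, mvs fS q1 s s' p2 & cut gX r s p2.
  move=> h1; have [_ w1 sp1] := cut_ends h1; rewrite e in w1.
  have [[r'' q1] /= hq _] := mvs_total fR w1.
  have [_ e1] := mvs_ends hq; rewrite -es in e1.
  have [[s'' p2] /= hq2 _] := mvs_total fS e1.
  have [h3 h4] := balE _ _ _ _ _ _ _ sp1 hq hq2.
  have [er es'] := cut_inj h3 h1; rewrite er es' in hq hq2.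
  by exists q1 => //; exists p2.
have [[r'' q] /= hq _] := mvs_total fR wp.
exists q; split=> [|r1 p1 h1]; first by rewrite -(mvs_size hq).
have [q0 hq0 [p2 h2 h3]] := key _ _ hp.
have [_ eq0] := mvs_fun hq hq0; rewrite {}eq0.
have [q1 hq1 [p3 h4 h5]] := key _ _ h1.
rewrite (cut_fun h3 h5) in h2.
by have [-> _] := mvs_inj h2 h4.
Qed.

(** Append [s] to phiR^(m)(psiX(r' s') r) = r' q for some [r'] and apply the balanced equation. *)
Lemma middle_mvs s' r q s p : middle s' r q -> cut gX r s p ->
  rng s' = src r -> mvs fS q s s' p.
Proof.
have /balancedP balE := bal; move=> -[sq hq] h e.
have [r' er'] := inR (src s').
have [p' hp'] := cut_total gX er'.
have {}hq := hq _ _ hp'.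
have [_ e1] := mvs_ends hq; have [e2 _ sp] := cut_ends h; rewrite e2 in e1.
have [[s'' p2] /= hq2 _] := mvs_total fS e1.
have [|h3 h4] := balE _ _ _ _ _ _ _ _ hq hq2; first by have [] := cut_ends hp'.
have [_ <-] := cut_inj h3 hp'.
by rewrite (cut_fun h h4).
Qed.

Lemma middle_walk s' r q : middle s' r q -> rng s' = src r ->
  walk (src s') q (rng r).
Proof.
move=> hq e; have [s es] := outS (rng r).
have [p hp] := cut_total gX (esym es).
by have [] := mvs_ends (middle_mvs hq hp e); rewrite es.
Qed.

Lemma middle_fun s' r q1 q2 : middle s' r q1 -> middle s' r q2 -> q1 = q2.
Proof.
move=> [_ h1] [_ h2].
have [r' er'] := inR (src s').
have [p' hp'] := cut_total gX er'.
by have [] := mvs_fun (h1 _ _ hp') (h2 _ _ hp').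
Qed.

(** [q] fixes the range of [r], so one [s] can be appended in both cases; phiS^(m)(q s) = s' psiX(r
    s) then gives back [s'] and, by decoding, [r]. *)
Lemma middle_inj s1 r1 s2 r2 q : rng s1 = src r1 -> rng s2 = src r2 ->
  middle s1 r1 q -> middle s2 r2 q -> s1 = s2 /\ r1 = r2.
Proof.
move=> e1 e2 h1 h2.
have [_ er] := walk_ends (middle_walk h1 e1) (middle_walk h2 e2) h1.1.
have [s es] := outS (rng r1).
have [p1 hp1] := cut_total gX (esym es); rewrite er in es.
have [p2 hp2] := cut_total gX (esym es).
have [e3 e4] := mvs_fun (middle_mvs h1 hp1 e1) (middle_mvs h2 hp2 e2).
by rewrite e4 in hp1; have [-> _] := cut_inj hp1 hp2.
Qed.

(** Append an edge [s] to [q], write phiS^(m)(q s) as s' p', and take for [r] the first component of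
    the preimage of p' under psiX. *)
Lemma middle_onto v w q : walk v q w -> size q = k.+1 ->
  {y | rng y.1 = src y.2 & middle y.1 y.2 q}.
Proof.
move=> hq sq; have [s es] := outS w; rewrite -es in hq.
have [[s' p'] /= h _] := mvs_total fS hq.
have [e1 e2] := mvs_ends h.
have sp : size p' = k.+1 by rewrite -(mvs_size h).
have [[r s1] /= hrs] := cut_onto gX e2 sp.
have [_ e3 _] := cut_ends hrs.
have [er _] := walk_ends e2 e3 sp.
exists (s', r) => //=.
have [q0 hq0] := middle_total er.
by have [<- _] := mvs_inj (middle_mvs hq0 hrs er) h.
Qed.

Lemma balanced_compatible : exists gY : piso (S ** R) (powS Y k),
  compatible_eq fR gX gY /\ compatible_eq fS gY gX.
Proof.
pose G (x : S ** R) (q : powS Y k) :=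
  middle (val x).1 (val x).2 (path_seq q).
have ev (x : S ** R) : rng (val x).1 = src (val x).2 by apply/eqP/(valP x).
have [] := @piso_of_graph _ _ (S ** R) (powS Y k) G.
- move=> x; have [q hq] := middle_total (ev x).
  have [p ep] := pow_of_size (middle_walk hq (ev x)) hq.1.
  by exists p; rewrite /G ep.
- move=> q.
  have [[s' r] /= /eqP e hq] := middle_onto (walk_path_seq q) (size_path_seq q).
  by exists (exist _ (s', r) e).
- by move=> x q1 q2 h1 h2; apply: path_seq_inj; apply: middle_fun h1 h2.
- move=> x1 x2 q h1 h2; have [e1 e2] := middle_inj (ev x1) (ev x2) h1 h2.
  by apply: val_inj; rewrite [LHS]surjective_pairing e1 e2 -surjective_pairing.
- move=> x q h.
  exact: walk_ends (walk_path_seq q) (middle_walk h (ev x)) (size_path_seq q).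
move=> gY hG; exists gY.
have cutY s' r q : cut gY s' r q -> middle s' r q.
  by move=> [x hx <-]; have := hG x; rewrite /G hx.
have /balancedP balE := bal.
split; apply/compatibleP.
  move=> p r r' q sp h.
  have [s es] := outS (rng r).
  have [_ e1] := mvs_ends h; rewrite -es in e1.
  have [[s' p2] /= h2 _] := mvs_total fS e1.
  have [h3 h4] := balE _ _ _ _ _ _ _ sp h h2.
  exists s' => //.
  have e : rng s' = src r.
    have [_ w1 _] := cut_ends h3; have [w2 _] := mvs_ends h.
    by have [] := walk_ends w1 w2 sp.
  have [q' hq'] := cut_total gY e.
  have [_ hm] := cutY _ _ _ hq'.
  by have [_ ->] := mvs_fun h (hm _ _ h3).
move=> q s s' p sq h.
have [w1 w2] := mvs_ends h.
have [[s'' r] /= hr] := cut_onto gY w1 sq.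
have [e1 w3 _] := cut_ends hr.
have e : rng r = src s by have [] := walk_ends w3 w1 sq.
have [p2 h2] := cut_total gX e.
have [e2 e3] := mvs_fun h (middle_mvs (cutY _ _ _ hr) h2 e1).
by exists r; rewrite ?e2 ?e3.
Qed.
End Middle.
End Implications.

(** Carry [r] leftwards through the k + 2 edges a l a'. Compatibility on the window l a' shows that
    [r2] arrives in front of [l], and on the window a l that [r1] arrives in front of [a]. *)
Lemma compatible_step (V W : finType) (X : span V V) (Y : span W W)
    (R : span V W) (S : span W V) k (fR : piso (X ** R) (R ** Y))
    (gX : piso (R ** S) (powS X k)) (gY : piso (S ** R) (powS Y k))
    (l : seq X) (a a' : X) r1 s1 r2 s2 (r : R) t b :
  compatible_eq fR gX gY -> cut gX r1 s1 (a :: l) ->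
  cut gX r2 s2 (rcons l a') -> rng a' = src r -> mv fR a r2 t b -> t = r1.
Proof.
move=> /compatibleP co h1 h2 e h.
have [_ w1 sl1] := cut_ends h1; have [_ w2 sl2] := cut_ends h2.
have [[r3 b3] /= h3] := mv_total fR e.
have [e3 _ e3' _] := mv_ends h3.
move: (w2); rewrite -cats1 => /walk_cat [u wl [eu _]].
rewrite -eu -e3' in wl.
have [[r4 q] /= h4 _] := mvs_total fR wl.
have : mvs fR (rcons l a') r r4 (rcons q b3).
  rewrite -!cats1; apply/mvs_cat; first exact: mvs_size h4.
  by exists r3 => //; exists r.
move=> /(co _ _ _ _ sl2) [s h5 _].
have [e4 _] := cut_inj h2 h5; rewrite -e4 in h4.
have : mvs fR (a :: l) r3 t (b :: q) by exists r2.
move=> /(co _ _ _ _ sl1) [s' h6 _].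
by have [] := cut_inj h1 h6.
Qed.

Lemma walk_extend (V : finType) (X : span V V) v (a : X) l w :
  (forall v, {x : X | src x = v}) -> walk v (a :: l) w ->
  {alpha : nat -> X | forall i, rng (alpha i) = src (alpha i.+1) &
    map alpha (iota 0 (size (a :: l))) = a :: l}.
Proof.
move=> out; elim: l a v => [|b l IH] a v [_ h].
  exists (fun i => iter i (fun x => sval (out (rng x))) a) => //= i.
  by rewrite (svalP (out _)).
have [alpha h1 h2] := IH _ _ h; have h3 : alpha 0 = b by case: h2.
exists (fun i => if i is j.+1 then alpha j else a).
  by case=> //; rewrite h3; case: h.
have e := iotaDl 1 0 (size (b :: l)); rewrite addn0 in e.
rewrite -[LHS]/(a :: map (fun i => if i is j.+1 then alpha j else a)
  (iota 1 (size (b :: l)))) e -map_comp.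
by congr cons; apply: h2.
Qed.

Lemma walk_map (V : finType) (X : span V V) (alpha : nat -> X) i n :
  (forall i, rng (alpha i) = src (alpha i.+1)) ->
  walk (src (alpha i)) (map alpha (iota i n)) (src (alpha (i + n))).
Proof.
move=> h; elim: n i => [|n IH] i /=; first by rewrite addn0.
by rewrite h addnS -addSn; split.
Qed.

Lemma mvs_map (V W : finType) (X : span V V) (R : span V W) (Y : span W W)
    (f : piso (X ** R) (R ** Y)) alpha beta rho i n :
  (forall i, mv f (alpha i) (rho i.+1) (rho i) (beta i)) ->
  mvs f (map alpha (iota i n)) (rho (i + n)) (rho i) (map beta (iota i n)).
Proof.
move=> h; elim: n i => [|n IH] i /=; first by rewrite addn0.
by exists (rho i.+1) => //; rewrite addnS -addSn.
Qed.

Lemma compatible_aligned (V W : finType) (X : span V V) (Y : span W W)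
    (R : span V W) (S : span W V) k
    (fR : piso (X ** R) (R ** Y)) (fS : piso (Y ** S) (S ** X))
    (gX : piso (R ** S) (powS X k)) (gY : piso (S ** R) (powS Y k)) :
  (forall v, {x : X | src x = v}) ->
  compatible_eq fR gX gY -> compatible_eq fS gY gX -> aligned_eq fR fS gX.
Proof.
move=> out co1 co2; apply/alignedP => a r2 r1 b s2 s1 a' l h1 h2 h3.
have [_ wl sl] := cut_ends h3.
have [e _ _ _] := mv_ends h1; rewrite -e in wl.
have [alpha ha] :=
  walk_extend out (conj (erefl (src a)) wl : walk _ (a :: l) _).
rewrite [size _]/= sl => el.
(* [w i] is the window of length m = k + 1 at position [i]; [rho i] and [sig i] decode it. *)
pose w i := map alpha (iota i k.+1).
have ww i : walk (src (alpha i)) (w i) (src (alpha (i + k.+1))).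
  exact: walk_map.
have sw i : size (w i) = k.+1 by rewrite size_map size_iota.
have hc i : {y | cut gX y.1 y.2 (w i)} := cut_onto gX (ww i) (sw i).
pose rho i := (sval (hc i)).1; pose sig i := (sval (hc i)).2.
have cw i : cut gX (rho i) (sig i) (w i) := svalP (hc i).
have er i : src (rho i) = src (alpha i).
  have [_ w1 _] := cut_ends (cw i).
  by have [] := walk_ends w1 (ww i) (sw i).
have hb i : {y | mv fR (alpha i) (rho i.+1) y.1 y.2}.
  by apply: mv_total; rewrite er.
pose beta i := (sval (hb i)).2.
have wS i : w i.+1 = rcons (map alpha (iota i.+1 k)) (alpha (i + k.+1)).
  rewrite /w -(addn1 k) iotaD map_cat cats1 /=; congr (rcons _ (alpha _)).
  by rewrite addn1 addSnnS.
have mb i : mv fR (alpha i) (rho i.+1) (rho i) (beta i).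
  have h := svalP (hb i); rewrite -/(beta i) in h.
  suff <- : (sval (hb i)).1 = rho i by [].
  (* The overlapping windows [w i] and [w i.+1] fit [compatible_step], the auxiliary edge being
     [rho] at i + k + 2. *)
  have h' := cw i.+1; rewrite wS in h'.
  apply: (compatible_step co1 (cw i) h' _ h).
  by rewrite ha; apply: esym (er _).
(* Carrying [rho (i + k.+1)] through [w i] yields [rho i] and a window of [beta], which
   compatibility identifies. *)
have hcY i : cut gY (sig i) (rho (i + k.+1)) (map beta (iota i k.+1)).
  have := mvs_map i k.+1 mb.
  move/compatibleP: (co1) => co /co [|s h4].
    by rewrite size_map size_iota.
  by have [_ ->] := cut_inj h4 (cw i).
have es i : rng (beta i) = src (sig i.+1).
  have [_ _ _ ->] := mv_ends (mb i).
  by have [-> _ _] := cut_ends (cw i.+1).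
have hd i : {y | mv fS (beta i) (sig i.+1) y.1 y.2} by apply: mv_total.
pose gam i := (sval (hd i)).2.
have bS i : map beta (iota i.+1 k.+1) =
    rcons (map beta (iota i.+1 k)) (beta (i + k.+1)).
  rewrite -(addn1 k) iotaD map_cat cats1 /=; congr (rcons _ (beta _)).
  by rewrite addn1 addSnnS.
have md i : mv fS (beta i) (sig i.+1) (sig i) (gam i).
  have h := svalP (hd i); rewrite -/(gam i) in h.
  suff <- : (sval (hd i)).1 = sig i by [].
  have h' := hcY i.+1; rewrite bS in h'.
  exact: (compatible_step co2 (hcY i) h' _ h).
(* Compatibility of [fS] makes the window of [gam] at 0 the image under psiX of [rho k.+1] and
   [sig k.+1], which is [w k.+1]; compare first edges. *)
have eg : gam 0 = alpha k.+1.
  have := mvs_map 0 k.+1 md.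
  move/compatibleP: (co2) => co /co [|r h4 h5].
    by rewrite size_map size_iota.
  have [_ er'] := cut_inj h4 (hcY 0); rewrite {}er' in h5.
  by have [-> _] := cut_fun h5 (cw (0 + k.+1)).
(* As [alpha] starts with [a :: l], the given edges are the terms of the sequences at positions 0
   and 1. *)
move: el => /= -[ea el].
have [e1 e2] : r2 = rho 1 /\ s2 = sig 1.
  by apply: (cut_inj h3); rewrite -el; apply: cw.
rewrite -ea e1 in h1; have [er1 eb] := mv_fun h1 (mb 0).
rewrite e2 eb in h2; have [es1 ea'] := mv_fun h2 (md 0).
exists (w 0); first by rewrite er1 es1; apply: cw.
rewrite ea' eg -ea -el.
have := congr1 (map alpha) (iotaD 0 k.+1 1).
by rewrite map_cat cats1 addn1 => h; apply: esym h.
Qed.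

(** * Strong shift equivalence of matrices *)

Section SSE.
Implicit Types V W U : finType.

Definition natmx_tr V W (F : natmx V W) : natmx W V := fun w v => F v w.

Lemma natmx_mul_tr V W U (R : natmx V W) (S : natmx W U) :
  natmx_tr (natmx_mul R S) =2 natmx_mul (natmx_tr S) (natmx_tr R).
Proof. by move=> u v; apply: eq_bigr => w _; rewrite mulnC. Qed.

Lemma sse_lagS n V W (A : natmx V V) (B : natmx W W) : 0 < n ->
  sse_lag n.+1 A B <-> exists (U : finType) (R : natmx V U) (S : natmx U V),
    A =2 natmx_mul R S /\ sse_lag n (natmx_mul S R) B.
Proof. by case: n. Qed.

Lemma sse_lag_eq n V W (A A' : natmx V V) (B B' : natmx W W) :
  A =2 A' -> B =2 B' -> sse_lag n A B -> sse_lag n A' B'.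
Proof.
elim: n V A A' => // n IH V A A' eA eB; case: (posnP n) => [->|n0].
  move=> [R [S [h1 h2]]]; exists R, S; split=> x y; first by rewrite -eA.
  by rewrite h2 eB.
move=> /(sse_lagS _ _ n0)[U [R [S [h1 h2]]]]; apply/(sse_lagS _ _ n0).
exists U, R, S; split; first by move=> x y; rewrite -eA.
exact: IH h2.
Qed.

Lemma sse_lag_add n n' V U W (A : natmx V V) (C : natmx U U) (B : natmx W W) :
  sse_lag n A C -> sse_lag n' C B -> sse_lag (n + n') A B.
Proof.
case: n' => [//|n'] + h.
elim: n V A => // n IH V A; case: (posnP n) => [->|n0].
  move=> [R [S [h1 h2]]]; apply/sse_lagS => //.
  exists U, R, S; split=> //; apply: sse_lag_eq h => // x y; exact: esym.
move=> /(sse_lagS _ _ n0)[U' [R [S [h1 h2]]]].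
rewrite addSn; apply/sse_lagS; first by rewrite addnS.
by exists U', R, S; split=> //; apply: IH.
Qed.

Lemma sse_trans V U W (A : natmx V V) (C : natmx U U) (B : natmx W W) :
  strong_shift_equivalent A C -> strong_shift_equivalent C B ->
  strong_shift_equivalent A B.
Proof.
move=> [n n0 h] [n' _ h']; exists (n + n'); first by rewrite addn_gt0 n0.
exact: sse_lag_add h h'.
Qed.

Lemma sse_elementary V W (A : natmx V V) (B : natmx W W) R S :
  A =2 natmx_mul R S -> natmx_mul S R =2 B -> strong_shift_equivalent A B.
Proof. by exists 1 => //; exists R, S. Qed.

(** Peels off the first elementary equivalence and hides the separate clause of [sse_lag] for lag
    1. *)
Lemma sse_lag_induction
    (P : forall V W, natmx V V -> natmx W W -> Prop) :
  (forall V W (A : natmx V V) (B : natmx W W) R S,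
    A =2 natmx_mul R S -> natmx_mul S R =2 B -> P V W A B) ->
  (forall V U W (A : natmx V V) (B : natmx W W)
      (R : natmx V U) (S : natmx U V), A =2 natmx_mul R S ->
    strong_shift_equivalent (natmx_mul S R) B ->
    P U W (natmx_mul S R) B -> P V W A B) ->
  forall V W (A : natmx V V) (B : natmx W W),
    strong_shift_equivalent A B -> P V W A B.
Proof.
move=> h1 hS V W A B [n _]; elim: n V A => // n IH V A.
case: (posnP n) => [->|n0]; first by move=> [R [S [? ?]]]; apply: h1 _ _.
move=> /(sse_lagS _ _ n0)[U [R [S [e h]]]].
by apply: hS e _ _; [exists n | apply: IH].
Qed.

Lemma sse_sym V W (A : natmx V V) (B : natmx W W) :
  strong_shift_equivalent A B -> strong_shift_equivalent B A.
Proof.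
move: V W A B; apply: sse_lag_induction => [V W A B R S h1 h2|].
  by apply: (@sse_elementary _ _ _ _ S R) => x y; apply: esym.
move=> V U W A B R S e _ h; apply: sse_trans h _.
by apply: (@sse_elementary _ _ _ _ S R) => // x y; apply: esym.
Qed.

(** Transposition reverses all arrows, so that a result about sources of lifts also serves for
    ranges. *)
Lemma sse_tr V W (A : natmx V V) (B : natmx W W) :
  strong_shift_equivalent A B ->
  strong_shift_equivalent (natmx_tr A) (natmx_tr B).
Proof.
have el (V' W' : finType) (C : natmx V' V') (D : natmx W' W') R S :
    C =2 natmx_mul R S -> natmx_mul S R =2 D ->
    strong_shift_equivalent (natmx_tr C) (natmx_tr D).
  move=> h1 h2; apply: (@sse_elementary _ _ _ _ (natmx_tr S) (natmx_tr R)).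
    by move=> x y; rewrite -natmx_mul_tr; apply: h1.
  by move=> x y; rewrite -natmx_mul_tr; apply: h2.
move: V W A B; apply: sse_lag_induction => [V W A B R S|]; first exact: el.
by move=> V U W A B R S e _; apply: sse_trans; apply: el e _.
Qed.

Lemma sse_eq V W (A A' : natmx V V) (B B' : natmx W W) :
  A =2 A' -> B =2 B' -> strong_shift_equivalent A B ->
  strong_shift_equivalent A' B'.
Proof. by move=> eA eB [n n0 h]; exists n => //; apply: sse_lag_eq h. Qed.

(** The two matrices are [F D] and [D F], where [D] is the graph of [f] and [F]
    counts the arrows [a] from [sigma a q'] to [q']. *)
Lemma sse_split (E Q Q' : finType) (f : Q -> Q') (g : E -> Q' -> bool)
    (sigma : E -> Q' -> Q) :
  strong_shift_equivalent
    (fun q1 q2 => #|[set a | g a (f q2) & sigma a (f q2) == q1]|)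
    (fun q1 q2 => #|[set a | g a q2 & f (sigma a q2) == q1]|).
Proof.
pose F : natmx Q Q' := fun q q' => #|[set a | g a q' & sigma a q' == q]|.
pose D : natmx Q' Q := fun q' q => (f q == q').
apply: (@sse_elementary _ _ _ _ F D) => [q1 q2|q1 q2].
  rewrite /natmx_mul (bigD1 (f q2)) //= /D eqxx muln1 big1 ?addn0 // => q.
  by rewrite eq_sym => /negPf->; rewrite muln0.
rewrite /natmx_mul /D -sum1_card.
rewrite (partition_big (fun a => sigma a q2) (fun q => f q == q1)) /=;
  last by move=> a; rewrite inE => /andP[].
rewrite [RHS]big_mkcond; apply: eq_bigr => q _.
case: eqP => [e|_]; last by rewrite mul0n.
rewrite mul1n /F -sum1_card; apply: eq_bigl => a; rewrite !inE -andbA.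
by case: eqP => [->|]; rewrite ?andbF // e eqxx.
Qed.
End SSE.

(** * From compatible shifts to strong shift equivalence *)

(** [delta] describes a graph on [Q] whose edges are in bijection, via [pi],
    with lifts of the edges of [Span s t] to a given range. If a path of length
    [m] determines the source of its lifts, merging indistinguishable states
    connects this graph to [Span s t] in [m + 1] elementary steps. *)
Section Synchronization.
Variables (E Q V : finType) (s t : E -> V) (pi : Q -> V) (delta : E -> Q -> Q).
Hypothesis pi_delta : forall a q, t a = pi q -> pi (delta a q) = s a.
Variable u : V -> Q.
Hypothesis pi_u : cancel u pi.
Variable m : nat.
Hypothesis sync : forall p v q q', walk (X := Span s t) v p (pi q) ->
  size p = m -> pi q = pi q' -> foldr delta q p = foldr delta q' p.

(** Two states are [k]-indistinguishable when pulling them back along any path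
    of length [k] gives the same state. *)
Fixpoint indist k (q q' : Q) : bool :=
  if k is k'.+1 then
    (pi q == pi q') &&
    [forall a, (t a == pi q) ==> indist k' (delta a q) (delta a q')]
  else q == q'.

Lemma indist_pi k q q' : indist k q q' -> pi q = pi q'.
Proof. by case: k => [/eqP->|k /andP[/eqP]]. Qed.

Lemma indist_delta k q q' a :
  indist k.+1 q q' -> t a = pi q -> indist k (delta a q) (delta a q').
Proof. by move=> /andP[_ /forallP/(_ a)] + e; rewrite e eqxx. Qed.

Lemma indist_refl k q : indist k q q.
Proof.
elim: k q => //= k IH q; rewrite eqxx.
by apply/forallP=> a; rewrite IH implybT.
Qed.

Lemma indist_sym k q q' : indist k q q' = indist k q' q.
Proof.
elim: k q q' => [|k IH] q q' /=; first by rewrite eq_sym.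
rewrite eq_sym; case: eqP => //= ->.
by apply: eq_forallb => a; rewrite IH.
Qed.

Lemma indist_trans k : transitive (indist k).
Proof.
elim: k => [|k IH] q2 q1 q3; first by move=> /eqP->.
move=> h1 h2; have e1 := indist_pi h1; have e2 := indist_pi h2.
rewrite /= e1 e2 eqxx; apply/forallP => a; apply/implyP => /eqP e.
apply: (IH (delta a q2)); first by apply: indist_delta h1 _; rewrite e1 e2.
by apply: indist_delta h2 _; rewrite e2.
Qed.

Lemma indistS k q q' : indist k q q' -> indist k.+1 q q'.
Proof.
elim: k q q' => [|k IH] q q' h; first by rewrite (eqP h) indist_refl.
rewrite /= (indist_pi h) eqxx; apply/forallP => a; apply/implyP => /eqP e.
by apply/IH/(indist_delta h); rewrite (indist_pi h).
Qed.

(** [foldr] applies the last edge of a path first, so each unfolding of [indist] takes one edge off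
    the end of the path in [sync]. *)
Lemma indist_sync q q' : pi q = pi q' -> indist m q q'.
Proof.
have : forall p v, walk (X := Span s t) v p (pi q) -> size p = m ->
    pi q = pi q' -> foldr delta q p = foldr delta q' p.
  by move=> p v; apply: sync.
elim: (m) q q' => [|k IH] q q' h e.
  by apply/eqP; apply: (h [::] (pi q)).
rewrite /= e eqxx; apply/forallP => a; apply/implyP => /eqP ea.
apply: IH; last by rewrite !pi_delta // e.
move=> p v hp sp _; rewrite -!foldr_rcons; apply: (h _ v) => //.
  rewrite -cats1; apply/walk_cat; exists (s a); last by rewrite e.
  by rewrite -(pi_delta (q := q)) // e.
by rewrite size_rcons sp.
Qed.

(** Canonical representatives let all the intermediate matrices be indexed by
    [Q] itself (with zero rows) instead of by quotients of [Q]. *)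
Definition repr k q := choose (indist k q) q.

Lemma indist_repr k q : indist k q (repr k q).
Proof. exact: chooseP (indist_refl _ _). Qed.

Lemma eq_repr k q q' : indist k q q' -> repr k q = repr k q'.
Proof.
move=> h; rewrite /repr (choose_id (indist_refl k q) h).
apply: eq_choose => q''; apply/idP/idP; apply: indist_trans; last exact: h.
by rewrite indist_sym.
Qed.

Definition merged k : natmx Q Q :=
  fun q1 q2 => #|[set a | t a == pi q2 & repr k (delta a q2) == q1]|.

(** Replacing [q2] by its representative for [k.+1] keeps the [k]-class of [delta a q2], and the
    [k]-class of a state determines its [k.+1]-class. *)
Lemma merged_step k : strong_shift_equivalent (merged k) (merged k.+1).
Proof.
have := sse_split (repr k.+1) (fun a q => t a == pi q)
  (fun a q => repr k (delta a q)).
apply: sse_eq => q1 q2; apply: eq_card => a; rewrite !inE.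
  have h := indist_repr k.+1 q2; rewrite -(indist_pi h).
  case: eqP => //= e; congr (_ == _); apply: esym.
  exact: eq_repr (indist_delta h e).
case: eqP => //= e; congr (_ == _); apply: esym; apply: eq_repr.
exact/indistS/indist_repr.
Qed.

Lemma sse_synchronized : strong_shift_equivalent
  (fun q1 q2 => #|[set a | t a == pi q2 & delta a q2 == q1]|)
  (fun v w => #|[set a | s a == v & t a == w]|).
Proof.
set A := (Z in strong_shift_equivalent _ Z).
(* By synchronization the [m]-classes are the fibres of [pi]; [u] picks a state in each. *)
have last : strong_shift_equivalent (merged m) A.
  have := sse_split pi (fun a v => t a == v)
    (fun a v => repr m (delta a (u v))).
  apply: sse_eq => q1 q2; apply: eq_card => a; rewrite !inE.
    case: eqP => //= e; congr (_ == _); apply/eq_repr/indist_sync.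
    by rewrite !pi_delta ?pi_u.
  rewrite [RHS]andbC; case: eqP => //= e.
  by rewrite -(indist_pi (indist_repr _ _)) pi_delta ?pi_u.
(* Descends to [merged 0], the graph of [delta] itself; past [m] the truncated subtraction makes the
   step trivial. *)
have all k : strong_shift_equivalent (merged (m - k)) A.
  elim: k => [|k IH]; first by rewrite subn0.
  have [h|h] := ltnP k m.
    by apply: sse_trans IH; have := merged_step (m - k.+1); rewrite subnSK.
  by move: IH; rewrite subnS (eqP (h : m - k == 0)).
have := all m; rewrite subnn; apply: sse_eq => // q1 q2.
apply: eq_card => a; rewrite !inE.
by have /eqP <- := indist_repr 0 (delta a q2).
Qed.
End Synchronization.

Section CompatibleSSE.
Variables (V W EX ER EY : finType).
Variables (sX tX : EX -> V) (sR : ER -> V) (tR : ER -> W) (sY tY : EY -> W).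
Let X := Span sX tX.
Let R := Span sR tR.
Let Y := Span sY tY.
Variable (f : piso (X ** R) (R ** Y)).

(** [a r] |-> [r' b] makes [R] the vertex set of a graph with an edge from [r']
    to [r]; its edges ending at [r] are indexed by [a] and those starting at [r']
    by [b]. The two functions compute the other end, with a junk value when
    [a r] or [r b] is not composable. *)
Definition pull_src (a : EX) (r : ER) : ER :=
  if insub (a, r) : option (X ** R) is Some x then (val (f x)).1 else r.

Definition push_rng (b : EY) (r : ER) : ER :=
  if insub (r, b) : option (R ** Y) is Some y then (val (pfun_inv f y)).2
  else r.

Lemma pull_srcE a r r' b : mv f a r r' b -> pull_src a r = r'.
Proof.
move=> [x ex ef]; rewrite /pull_src.
by rewrite -ex valK ef.
Qed.

Lemma push_rngE a r r' b : mv f a r r' b -> push_rng b r' = r.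
Proof.
move=> [x ex ef]; rewrite /push_rng.
by rewrite -ef valK pfunK ex.
Qed.

Lemma foldr_pull_src p r r' q : mvs f p r r' q -> foldr pull_src r p = r'.
Proof. by elim: p q r' => [|a p IH] [|b q] r' //= [r1 /IH-> /pull_srcE]. Qed.

Lemma foldr_push_rng p r r' q :
  mvs f p r r' q -> foldr push_rng r' (rev q) = r.
Proof.
elim: p q r' => [|a p IH] [|b q] r' //= [r1 /IH <- /push_rngE e].
by rewrite rev_cons foldr_rcons e.
Qed.

Lemma walk_rev p v w :
  walk (X := Span tY sY) v p w -> walk (X := Y) w (rev p) v.
Proof.
elim: p v => [|b p IH] v /= => [-> //|[<- /IH h]].
by rewrite rev_cons -cats1; apply/walk_cat; exists (sY b).
Qed.

(** Both sides count the pairs a q2 that [f] sends to some q1 b, once by [a] and once by [b]. *)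
Lemma card_pull_push q1 q2 :
  #|[set a | tX a == sR q2 & pull_src a q2 == q1]| =
  #|[set b | sY b == tR q1 & push_rng b q1 == q2]|.
Proof.
pose T : finType := {xy : EX * ER | tX xy.1 == sR xy.2}.
pose Z := [set x : T | ((val x).2 == q2) && ((val (f x)).1 == q1)].
have -> : [set a | tX a == sR q2 & pull_src a q2 == q1] =
    [set (val x).1 | x in Z].
  apply/setP => a; rewrite inE; apply/andP/imsetP => [[/eqP h /eqP h']|[x]].
    have [[r' b] /= m] := @mv_total _ _ _ _ _ _ _ _ f a q2 h.
    have [x ex ef] := m; exists x; last by rewrite ex.
    by rewrite inE ex ef /= -(pull_srcE m) h' !eqxx.
  rewrite inE => /andP[/eqP h /eqP h'] ->.
  have m : mv f (val x).1 (val x).2 (val (f x)).1 (val (f x)).2.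
    by exists x => //; apply: surjective_pairing.
  rewrite -h (pull_srcE m) h' eqxx; split=> //.
  by have [/= -> _ _ _] := mv_ends m.
have -> : [set b | sY b == tR q1 & push_rng b q1 == q2] =
    [set (val (f x)).2 | x in Z].
  apply/setP => b; rewrite inE; apply/andP/imsetP => [[/eqP h /eqP h']|[x]].
    have [[a r] /= m] := @mv_onto _ _ _ _ _ _ _ _ f q1 b (esym h).
    have [x ex ef] := m; exists x; last by rewrite ef.
    by rewrite inE ex ef /= -(push_rngE m) h' !eqxx.
  rewrite inE => /andP[/eqP h /eqP h'] ->.
  have m : mv f (val x).1 (val x).2 (val (f x)).1 (val (f x)).2.
    by exists x => //; apply: surjective_pairing.
  rewrite -h' (push_rngE m) h eqxx; split=> //.
  by have [/= _ -> _ _] := mv_ends m.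
rewrite !card_in_imset // => x y; rewrite !inE => /andP[/eqP h1 /eqP h2];
  move=> /andP[/eqP h3 /eqP h4] h5.
  apply: (can_inj (pfunK f)); apply: val_inj.
  by rewrite [LHS]surjective_pairing [RHS]surjective_pairing h2 h4 h5.
apply: val_inj.
by rewrite [LHS]surjective_pairing [RHS]surjective_pairing h1 h3 h5.
Qed.

Variables (S : span W V) (k : nat).
Variables (gX : piso (R ** S) (powS X k)) (gY : piso (S ** R) (powS Y k)).

Lemma compatible_sse : compatible_eq f gX gY ->
  (forall v, exists r, sR r = v) -> (forall w, exists r, tR r = w) ->
  strong_shift_equivalent
    (fun v w => #|[set a | sX a == v & tX a == w]|)
    (fun v w => #|[set b | sY b == v & tY b == w]|).
Proof.
move=> /compatibleP co /fin_all_exists[u uK] /fin_all_exists[u' uK'].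
have pull a q : tX a = sR q -> sR (pull_src a q) = sX a.
  move=> h; have [[r' b] /= m] := @mv_total _ _ _ _ _ _ _ _ f a q h.
  by rewrite (pull_srcE m); have [_ _ e _] := mv_ends m; apply: e.
have push b q : sY b = tR q -> tR (push_rng b q) = tY b.
  move=> h; have [[a r] /= m] := @mv_onto _ _ _ _ _ _ _ _ f q b (esym h).
  by rewrite (push_rngE m); have [_ _ _ e] := mv_ends m; apply: esym e.
(* By compatibility the first end of the lift is the [R]-component of the preimage of [p] under
   psiX, whatever [q] is. *)
have syncX p v q q' : walk (X := X) v p (sR q) -> size p = k.+1 ->
    sR q = sR q' -> foldr pull_src q p = foldr pull_src q' p.
  move=> h sp e; have h' := h; rewrite e in h'.
  have [[r1 p1] /= m1 _] := mvs_total (r := q) f h.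
  have [[r2 p2] /= m2 _] := mvs_total (r := q') f h'.
  rewrite (foldr_pull_src m1) (foldr_pull_src m2).
  have [s1 c1 _] := co _ _ _ _ sp m1; have [s2 c2 _] := co _ _ _ _ sp m2.
  by have [] := cut_inj c1 c2.
(* With arrows reversed, the other end is the [R]-component of the preimage of [rev p] under
   psiY. *)
have syncY p v q q' : walk (X := Span tY sY) v p (tR q) -> size p = k.+1 ->
    tR q = tR q' -> foldr push_rng q p = foldr push_rng q' p.
  move=> /walk_rev h sp e; have h' := h; rewrite e in h'.
  rewrite -size_rev in sp.
  have [[p1 r1] /= m1] := mvs_onto (r' := q) f h.
  have [[p2 r2] /= m2] := mvs_onto (r' := q') f h'.
  rewrite -(revK p) (foldr_push_rng m1) (foldr_push_rng m2).
  rewrite -(mvs_size m1) in sp.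
  have [s1 _ c1] := co _ _ _ _ sp m1.
  rewrite (mvs_size m1) -(mvs_size m2) in sp.
  have [s2 _ c2] := co _ _ _ _ sp m2.
  by have [] := cut_inj c1 c2.
have hX := sse_synchronized pull uK syncX.
have hY := sse_tr (sse_synchronized push uK' syncY).
(* Both equivalences start from the same graph on [R], by [card_pull_push]. *)
apply: sse_trans (sse_sym hX) _.
apply: sse_eq hY => q1 q2; rewrite /natmx_tr; first by rewrite card_pull_push.
by apply: eq_card => b; rewrite !inE andbC.
Qed.
End CompatibleSSE.

(** * Finite edge sets and counting *)

Section Edges.
Variables (V W : finType) (F : natmx V W).

Definition edge_code (e : edges F) : {i : V * W & 'I_(F i.1 i.2)} :=
  @Tagged _ ((val e).1.1, (val e).2) (fun i => 'I_(F i.1 i.2))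
    (Ordinal (valP e)).

Definition edge_decode (i : {i : V * W & 'I_(F i.1 i.2)}) : edges F :=
  exist _ ((tag i).1, tagged i : nat, (tag i).2) (ltn_ord (tagged i)).

Lemma edge_codeK : cancel edge_code edge_decode.
Proof. by case=> -[[v n] w] h; apply: val_inj. Qed.

(** Convertible to [edges F], which is not canonically finite because its
    definition mentions [nat]. *)
Definition edge_fin : finType := can_type edge_codeK.

Lemma card_edges v w :
  #|[set e : edge_fin | src (e : edges F) == v & rng (e : edges F) == w]|
  = F v w.
Proof.
pose h (i : 'I_(F v w)) : edge_fin :=
  exist (fun e : V * nat * W => e.1.2 < F e.1.1 e.2) (v, i : nat, w)
    (ltn_ord i).
have hI : injective h by move=> i j [/val_inj].
rewrite -[RHS]card_ord -cardsT -(card_imset _ hI); apply: eq_card => e.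
rewrite inE; apply/andP/imsetP => [[/eqP h1 /eqP h2]|[i _ ->]]; last first.
  by rewrite /= !eqxx.
case: e h1 h2 => -[[v' n] w'] lt /= ev ew; subst v' w'.
by exists (Ordinal lt) => //; apply: val_inj.
Qed.
End Edges.

Lemma card_fibprod (V U W E E' : finType) (s : E -> V) (t : E -> U)
    (s' : E' -> U) (t' : E' -> W) v w :
  #|[set x : {xy : E * E' | t xy.1 == s' xy.2} |
      s (val x).1 == v & t' (val x).2 == w]| =
  natmx_mul (fun v u => #|[set e | s e == v & t e == u]|)
    (fun u w => #|[set e | s' e == u & t' e == w]|) v w.
Proof.
rewrite /natmx_mul -sum1_card.
rewrite (partition_big (fun x => t (val x).1) predT) //=.
apply: eq_bigr => u _.
(* Both sets are mapped injectively into [option (E * E')] and compared there. *)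
rewrite -cardsX sum1_card -[RHS](card_imset _ (@Some_inj _)).
rewrite -[LHS](card_in_imset (f := Some \o val)); last first.
  by move=> x y _ _ [] /(@val_inj _ _ _).
apply: eq_card => -[[e e']|]; last first.
  by apply/imsetP/imsetP => -[].
apply/imsetP/imsetP => -[].
  move=> [[e1 e2] h]; rewrite unfold_in /= inE.
  move=> /andP[/andP[h1 h2] h3] [-> ->].
  by exists (e1, e2) => //; rewrite !inE /= h1 h2 h3 -(eqP h) h3.
move=> [e1 e2]; rewrite !inE /= => /andP[/andP[h1 h2] /andP[h3 h4]] [-> ->].
have h : t (e1, e2).1 == s' (e1, e2).2 by rewrite /= (eqP h2) eq_sym.
by exists (exist _ (e1, e2) h) => //; rewrite unfold_in /= inE /= h1 h2 h4.
Qed.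

(** The edge [(v, n, w)] goes to the [n]-th element in an enumeration of the fibre over [v] and
    [w]. *)
Lemma piso_of_card (V W E : finType) (s : E -> V) (t : E -> W)
    (F : natmx V W) :
  (forall v w, F v w = #|[set e | s e == v & t e == w]|) ->
  inhabited (piso (edges F) (Span s t)).
Proof.
move=> hF.
pose fib v w := enum [set e | s e == v & t e == w].
have sz v w : size (fib v w) = F v w by rewrite hF cardE.
pose G (x : edges F) (e : Span s t) :=
  [/\ src x = s e, rng x = t e & (val x).1.2 = index e (fib (s e) (t e))].
have mem e : (e : E) \in fib (s e) (t e) by rewrite mem_enum inE !eqxx.
have [] := @piso_of_graph _ _ (edges F) (Span s t) G.
- case=> -[[v n] w] h; have h' : n < size (fib v w) by rewrite sz.
  (* [nth] needs a default; the fibre is nonempty because [n] is below its size. *)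
  have [e0 _] : {e0 : E | true} by case: (fib v w) h' => // e0 *; exists e0.
  have := mem_nth e0 h'; rewrite mem_enum inE => /andP[/eqP e1 /eqP e2].
  exists (nth e0 (fib v w) n); split=> //=; rewrite e1 e2.
  by rewrite index_uniq ?enum_uniq.
- move=> e; have h : (s e, index e (fib (s e) (t e)), t e).1.2 < F (s e) (t e).
    by rewrite -sz index_mem.
  by exists (exist _ (s e, index e (fib (s e) (t e)), t e) h).
- move=> x e1 e2 [h1 h2 h3] [h4 h5 h6].
  have m1 := mem e1; have m2 := mem e2.
  rewrite -h1 -h2 in h3 m1; rewrite -h4 -h5 in h6 m2.
  by rewrite -(nth_index e1 m1) -(nth_index e1 m2) -h3 -h6.
- move=> [[[v n] w] h] [[[v' n'] w'] h'] e [/= h1 h2 h3] [/= h4 h5 h6].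
  by apply: val_inj; rewrite /= h1 h2 h3 h4 h5 h6.
- by move=> x e [h1 h2 _].
by move=> f _; exists.
Qed.

Lemma piso_natmx_mul (V U W : finType) (R : natmx V U) (S : natmx U W)
    (F : natmx V W) : F =2 natmx_mul R S ->
  inhabited (piso (edges F) (edges R ** edges S)).
Proof.
move=> hF; pose ER := edge_fin R; pose ES := edge_fin S.
pose T : finType := {xy : ER * ES |
  rng (xy.1 : edges R) == src (xy.2 : edges S)}.
apply: (@piso_of_card _ _ T (fun x => src ((val x).1 : edges R))
  (fun x => rng ((val x).2 : edges S))) => v w.
rewrite hF [RHS](@card_fibprod V U W ER ES
  (@src _ _ (edges R)) (@rng _ _ (edges R))
  (@src _ _ (edges S)) (@rng _ _ (edges S))).
by apply: eq_bigr => u _; rewrite !card_edges.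
Qed.

Lemma compatible_edges_sse (V W : finType) (A : natmx V V) (B : natmx W W)
    (R : natmx V W) (S : span W V) k
    (f : piso (edges A ** edges R) (edges R ** edges B))
    (gX : piso (edges R ** S) (powS (edges A) k))
    (gY : piso (S ** edges R) (powS (edges B) k)) :
  compatible_eq f gX gY ->
  (forall v, exists r : edges R, src r = v) ->
  (forall w, exists r : edges R, rng r = w) -> strong_shift_equivalent A B.
Proof.
move=> co outR inR.
have := @compatible_sse V W (edge_fin A) (edge_fin R) (edge_fin B)
  (@src _ _ (edges A)) (@rng _ _ (edges A)) (@src _ _ (edges R))
  (@rng _ _ (edges R)) (@src _ _ (edges B)) (@rng _ _ (edges B))
  f S k gX gY co outR inR.
by apply: sse_eq => v w; rewrite card_edges.
Qed.

(** * From strong shift equivalence to aligned shifts *)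

Lemma mv_pinv (V U U' W : finType) (X : span V U) (R : span U W)
    (R' : span V U') (Y : span U' W) (f : piso (X ** R) (R' ** Y)) a r r' b :
  mv f a r r' b -> mv (pinv f) r' b a r.
Proof. by move=> [x ex ef]; exists (f x); rewrite //= pfunK. Qed.

(** * Composition of aligned shifts *)

Section Bracket.
Variables (V U U' W : finType).
Variables (P : span V U) (Q : span U U') (S : span U' W) (T : span V U').
Variable (g : piso (P ** Q) T).

Definition bracket : piso (P ** (Q ** S)) (T ** S) :=
  (g *P pid S) \oP pinv (passoc P Q S).

Lemma mv_bracket (p : P) (qs : Q ** S) (s : S) (x : P ** Q) :
  rng p = src qs -> (val qs).2 = s -> val x = (p, (val qs).1) ->
  mv bracket p qs (g x) s.
Proof.
move=> /eqP h es ex; exists (exist _ (p, qs) h) => //=.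
by rewrite es; congr (g _, _); apply: val_inj; rewrite ex.
Qed.
End Bracket.

Section PhiComposition.
Variables (V U W : finType) (X : span V V) (Z : span U U) (Y : span W W).
Variables (R : span V U) (R' : span U W).
Variables (f : piso (X ** R) (R ** Z)) (f' : piso (Z ** R') (R' ** Y)).

Definition phi_comp : piso (X ** (R ** R')) ((R ** R') ** Y) :=
  pinv (passoc R R' Y) \oP (pid R *P f') \oP passoc R Z R'
    \oP (f *P pid R') \oP pinv (passoc X R R').

Lemma mv_phi_comp a (x x' : R ** R') b : mv phi_comp a x x' b ->
  exists2 z, mv f a (val x).1 (val x').1 z & mv f' z (val x).2 (val x').2 b.
Proof.
move=> m; have [e _ _ _] := mv_ends m; have [y ey ef] := m.
have ty : tripr y a (val x).1 (val x).2.
  by rewrite /tripr ey; split=> //; apply: surjective_pairing.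
have [e1 e2] := tripr_ends ty.
have [[r1 z] /= m1] := mv_total f e1.
have [_ _ _ e3] := mv_ends m1; rewrite -e3 in e2.
have [[r2 b'] /= m2] := mv_total f' e2.
have := tripl_passoc (tripr_pprod (tripr_passoc (tripl_pprod
  (tripl_passoc ty) m1)) m2).
rewrite -[Z in tripl Z]/(phi_comp y) /tripl ef /= => -[ex' eb].
by exists z; rewrite ex' ?eb.
Qed.
End PhiComposition.

Section Composition.
Variables (V U W : finType) (X : span V V) (Z : span U U) (Y : span W W).
Variables (R : span V U) (S : span U V) (R' : span U W) (S' : span W U).
Variable k : nat.
Variables (fR : piso (X ** R) (R ** Z)) (fS : piso (Z ** S) (S ** X)).
Variables (gX : piso (R ** S) (powS X 0)) (gZ : piso (S ** R) (powS Z 0)).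
Variables (fR' : piso (Z ** R') (R' ** Y)) (fS' : piso (Y ** S') (S' ** Z)).
Variables (gZ' : piso (R' ** S') (powS Z k)) (gY : piso (S' ** R') (powS Y k)).

(** On r r' s' s: [gZ'] turns r' s' into a path z, the inverse of phi_R^(k+1) turns r z into p r0,
    and [gX] turns r0 s into one last edge after p. *)
Definition psi_comp_l : piso ((R ** R') ** (S' ** S)) (powS X k.+1) :=
  psnoc X k \oP (pid (powS X k) *P gX) \oP passoc (powS X k) R S
    \oP (pinv (phi_pow fR k) *P pid S) \oP pinv (passoc R (powS Z k) S)
    \oP (pid R *P bracket S gZ') \oP passoc R R' (S' ** S).

(** On s' s r r': [gZ] has lag 1 and turns s r into a single edge z, the inverse of [fS'] turns s' z
    into b s0, and [gY] turns s0 r' into the path after b. *)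
Definition psi_comp_r : piso ((S' ** S) ** (R ** R')) (powS Y k.+1) :=
  (pid Y *P gY) \oP passoc Y S' R' \oP (pinv fS' *P pid R')
    \oP pinv (passoc S' Z R') \oP (pid S' *P bracket R' gZ)
    \oP passoc S' S (R ** R').

Lemma cut_psi_comp_l (x : R ** R') (y : S' ** S) l : cut psi_comp_l x y l ->
  exists z p r a, [/\ cut gZ' (val x).2 (val y).1 z,
    mvs fR p r (val x).1 z, cut gX r (val y).2 [:: a] & l = rcons p a].
Proof.
move=> [e ee el].
have te : tripl e (val x).1 (val x).2 y.
  by rewrite /tripl ee; split=> //; apply: surjective_pairing.
have t1 := tripr_passoc te; have [e1 e2] := tripr_ends t1.
have [c ec] : {c : R' ** S' | val c = ((val x).2, (val y).1)}.
  by move/eqP: (e2) => h; exists (exist _ ((val x).2, (val y).1) h).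
have t2 := tripl_passoc (tripr_pprod t1 (mv_bracket gZ' e2 erefl ec)).
have [e3 e4] := tripr_ends (tripr_passoc t2).
have [[p r] /= m] := @mv_onto _ _ _ _ _ _ _ _ (phi_pow fR k) _ _ e3.
have t3 := tripr_passoc (tripl_pprod t2 (mv_pinv m)).
have [_ e5] := tripr_ends t3.
have [d ed] : {d : R ** S | val d = (r, (val y).2)}.
  by move/eqP: (e5) => h; exists (exist _ (r, (val y).2) h).
exists (path_seq (gZ' c)), (path_seq p), r, (gX d : X).
split; first by exists c.
- exact/mv_phi_pow.
- by exists d.
set t := (T in tripr T) in t3.
rewrite -el -[path_seq _]/(path_seq
  (psnoc X k ((pid (powS X k) *P gX) t) : powS X k.+1)); clearbody t.
rewrite path_seq_psnoc; case: t3 => e6 t3.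
rewrite -e6; congr (rcons _ (gX _)); apply: val_inj.
by rewrite t3 ed.
Qed.

Lemma cut_psi_comp_r (y : S' ** S) (x : R ** R') l : cut psi_comp_r y x l ->
  exists z b s l', [/\ cut gZ (val y).2 (val x).1 [:: z],
    mv fS' b s (val y).1 z, cut gY s (val x).2 l' & l = b :: l'].
Proof.
move=> [e ee el].
have te : tripl e (val y).1 (val y).2 x.
  by rewrite /tripl ee; split=> //; apply: surjective_pairing.
have t1 := tripr_passoc te; have [e1 e2] := tripr_ends t1.
have [c ec] : {c : S ** R | val c = ((val y).2, (val x).1)}.
  by move/eqP: (e2) => h; exists (exist _ ((val y).2, (val x).1) h).
have t2 := tripl_passoc (tripr_pprod t1 (mv_bracket gZ e2 erefl ec)).
have [e3 e4] := tripr_ends (tripr_passoc t2).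
have [[b s] /= m] := @mv_onto _ _ _ _ _ _ _ _ fS' _ _ e3.
have t3 := tripr_passoc (tripl_pprod t2 (mv_pinv m)).
have [_ e5] := tripr_ends t3.
have [d ed] : {d : S' ** R' | val d = (s, (val x).2)}.
  by move/eqP: (e5) => h; exists (exist _ (s, (val x).2) h).
exists (gZ c : Z), b, s, (path_seq (gY d)).
split; [by exists c| by []|by exists d|].
set t := (T in tripr T) in t3.
rewrite -el -[path_seq _]/(path_seq ((pid Y *P gY) t : powS Y k.+1)).
clearbody t; case: t3 => e6 t3.
by rewrite -e6; congr (_ :: path_seq (gY _)); apply: val_inj; rewrite t3 ed.
Qed.

Lemma aligned_comp_l : aligned_eq fR fS gX -> aligned_eq fR' fS' gZ' ->
  aligned_eq (phi_comp fR fR') (phi_comp fS' fS) psi_comp_l.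
Proof.
move=> /alignedP al /alignedP al'; apply/alignedP.
move=> a0 x2 x1 b0 y2 y1 a0' l hR hS hc.
have [_ e0 _ _] := mv_ends hR; have [_ _ e0' _] := mv_ends hS.
have [z0 m1 m2] := mv_phi_comp hR; have [z0' m3 m4] := mv_phi_comp hS.
have [z2 [p2 [t2 [a2 [c2 ms2 d2 el]]]]] := cut_psi_comp_l hc.
have [l1 hl1] : {l1 | cut psi_comp_l x1 y1 l1}.
  by apply: cut_total; rewrite e0' e0.
have [z1 [p1 [t1 [a1 [c1 ms1 d1 el1]]]]] := cut_psi_comp_l hl1.
have [z1' c1' ez] := al' _ _ _ _ _ _ _ _ m2 m3 c2.
rewrite {}(cut_fun c1' c1) in ez.
exists l1 => //; rewrite el1 el.
(* Alignment at [Z] rewrites z0 z2 as z1 z0', so the path a0 p2 can be cut before its last edge: the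
   front is [p1], and the last edge enters the aligned equation for [gX]. *)
have : mvs fR (a0 :: p2) t2 (val x1).1 (z0 :: z2) by exists (val x2).1.
rewrite -ez; case/lastP E: (a0 :: p2) => [//|q a3].
rewrite -!cats1 => h.
have sq : size q = size z1.
  by have := mvs_size h; rewrite !size_cat !addn1 => -[].
have [t3 [t3' /= <- m5] h2] := (mvs_cat _ _ _ _ _ sq).1 h.
have [l3 c3 e3] := al _ _ _ _ _ _ _ _ m5 m4 d2.
have [_ _ sl3] := cut_ends c3.
case: l3 sl3 c3 e3 => [|a4 [|? ?]] // _ c3 [e4 e5].
have [e7 e8] := mvs_inj h2 ms1.
rewrite -e8 in d1; have [e9] := cut_fun c3 d1.
by rewrite -e9 e4 -e7 e5 !cats1 -E.
Qed.

(** Alignment at [Z] has lag 1 here, so it forces z1 = z0 and z0' = z2; alignment of [gY] does the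
    rest. *)
Lemma aligned_comp_r : aligned_eq fS fR gZ -> aligned_eq fS' fR' gY ->
  aligned_eq (phi_comp fS' fS) (phi_comp fR fR') psi_comp_r.
Proof.
move=> /alignedP al /alignedP al'; apply/alignedP.
move=> b0 y2 y1 a0 x2 x1 b0' p hS hR hc.
have [_ e0 _ _] := mv_ends hS; have [_ _ e0' _] := mv_ends hR.
have [z0 m1 m2] := mv_phi_comp hS; have [z0' m3 m4] := mv_phi_comp hR.
have [z2 [b2 [t2 [l2 [c2 ms2 d2 el]]]]] := cut_psi_comp_r hc.
have [l1 hl1] : {l1 | cut psi_comp_r y1 x1 l1}.
  by apply: cut_total; rewrite e0' e0.
have [z1 [b1 [t1 [l1' [c1 ms1 d1 el1]]]]] := cut_psi_comp_r hl1.
exists l1 => //; rewrite el1 el.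
have [w1 c1' ez] := al _ _ _ _ _ _ _ _ m2 m3 c2.
rewrite {}(cut_fun c1' c1) in ez; case: ez => ez1 ez2.
rewrite ez2 in m4; have [l3 c3 e3] := al' _ _ _ _ _ _ _ _ ms2 m4 d2.
rewrite ez1 in ms1; have [eb et] := mv_inj ms1 m1.
by rewrite et in d1; rewrite /= eb (cut_fun d1 c3) e3.
Qed.
End Composition.

(** At lag 1 the two equations give a = psiX(r1 s1) and a' = psiX(r2 s2) at once. No path is
    extended, which matters because intermediate matrices of a strong shift equivalence may have
    zero rows. *)
Lemma compatible_aligned_lag1 (V W : finType) (X : span V V) (Y : span W W)
    (R : span V W) (S : span W V)
    (fR : piso (X ** R) (R ** Y)) (fS : piso (Y ** S) (S ** X))
    (gX : piso (R ** S) (powS X 0)) (gY : piso (S ** R) (powS Y 0)) :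
  compatible_eq fR gX gY -> compatible_eq fS gY gX -> aligned_eq fR fS gX.
Proof.
move=> /compatibleP coR /compatibleP coS; apply/alignedP.
move=> a r2 r1 b s2 s1 a' l m1 m2 c.
have [||s c1 c2] := coR [:: a] r2 r1 [:: b]; [by []|by exists r2|].
have [||r c3 c4] := coS [:: b] s2 s1 [:: a']; [by []|by exists s2|].
have [es er] := cut_inj c2 c3; rewrite es in c1; rewrite -er in c4.
by exists [:: a] => //; rewrite (cut_fun c c4).
Qed.

Section Transport.
Variables (V W : finType) (X : span V V) (Y : span W W).
Variables (R R' : span V W) (S S' : span W V).
Variables (iR : piso R' R) (iS : piso S' S).

(** Composition yields fibered products of edge sets, but a concrete shift is made of matrices;
    conjugating by [piso_natmx_mul] passes to the product matrices. *)
Definition phi_transport (f : piso (X ** R) (R ** Y)) :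
    piso (X ** R') (R' ** Y) :=
  (pinv iR *P pid Y) \oP f \oP (pid X *P iR).

Lemma mv_transport f a r r' b :
  mv (phi_transport f) a r r' b -> mv f a (iR r) (iR r') b.
Proof.
move=> [x ex ef]; exists ((pid X *P iR) x); first by rewrite /= ex.
move: ef; rewrite [LHS]/= => -[<- <-]; rewrite pfun_invK.
exact: surjective_pairing.
Qed.

Lemma cut_transport k (g : piso (R ** S) (powS X k)) r s l :
  cut (g \oP (iR *P iS)) r s l <-> cut g (iR r) (iS s) l.
Proof.
split=> [[x ex <-]|[y ey <-]].
  by exists ((iR *P iS) x) => //=; rewrite ex.
have h : rng r == src s.
  by have := valP y; rewrite /= ey /= rng_pfun src_pfun.
by exists (exist _ (r, s) h) => //=; congr (path_seq (g _)); apply: val_inj.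
Qed.
End Transport.

Lemma aligned_transport (V W : finType) (X : span V V) (Y : span W W)
    (R R' : span V W) (S S' : span W V) (iR : piso R' R) (iS : piso S' S) k
    (fR : piso (X ** R) (R ** Y)) (fS : piso (Y ** S) (S ** X))
    (g : piso (R ** S) (powS X k)) :
  aligned_eq fR fS g ->
  aligned_eq (phi_transport iR fR) (phi_transport iS fS) (g \oP (iR *P iS)).
Proof.
move=> /alignedP al; apply/alignedP => a r2 r1 b s2 s1 a' l.
move=> /mv_transport h1 /mv_transport h2 /cut_transport h3.
have [l' c e] := al _ _ _ _ _ _ _ _ h1 h2 h3.
by exists l' => //; apply/cut_transport.
Qed.

Lemma sse_aligned (V W : finType) (A : natmx V V) (B : natmx W W) :
  strong_shift_equivalent A B ->
  exists2 m, 0 < m & aligned_shift_related A B m.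
Proof.
move: V W A B; apply: sse_lag_induction => [V W A B R S eA eB|].
  have [iA] := piso_natmx_mul eA.
  have [iB] := piso_natmx_mul (fun x y => esym (eB x y)).
  pose gA : piso _ (powS (edges A) 0) := pinv iA.
  pose gB : piso _ (powS (edges B) 0) := pinv iB.
  (* [fR] and [fS] are read off the compatibility equations for lag 1, which thus hold by
     definition. *)
  pose fR := (pid (edges R) *P gB) \oP passoc _ _ _ \oP (pinv gA *P pid _).
  pose fS := (pid (edges S) *P gA) \oP passoc _ _ _ \oP (pinv gB *P pid _).
  exists 1 => //.
  exists (@ConcreteShift _ _ A B 1 R S fR fS gA gB).
  by split; apply: compatible_aligned_lag1.
move=> V U W A B R S eA _ [[//|k] _ [[R' S' fR' fS' gZ' gY] [/= al1 al2]]].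
have [iA] := piso_natmx_mul eA.
have [iC] := piso_natmx_mul (fun x y => erefl (natmx_mul S R x y)).
pose gA : piso _ (powS (edges A) 0) := pinv iA.
pose gC : piso _ (powS (edges (natmx_mul S R)) 0) := pinv iC.
pose fR := (pid (edges R) *P gC) \oP passoc _ _ _ \oP (pinv gA *P pid _).
pose fS := (pid (edges S) *P gA) \oP passoc _ _ _ \oP (pinv gC *P pid _).
have al3 : aligned_eq fR fS gA.
  exact: (@compatible_aligned_lag1 _ _ _ _ _ _ _ _ _ gC).
have al4 : aligned_eq fS fR gC.
  exact: (@compatible_aligned_lag1 _ _ _ _ _ _ _ _ _ gA).
have [iR] := piso_natmx_mul (fun x y => erefl (natmx_mul R R' x y)).
have [iS] := piso_natmx_mul (fun x y => erefl (natmx_mul S' S x y)).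
exists k.+2 => //.
exists (@ConcreteShift _ _ A B k.+2 _ _ (phi_transport iR (phi_comp fR fR'))
  (phi_transport iS (phi_comp fS' fS))
  (psi_comp_l fR gA gZ' \oP (iR *P iS)) (psi_comp_r gC fS' gY \oP (iS *P iR))).
by split; apply: aligned_transport;
  [apply: aligned_comp_l | apply: aligned_comp_r].
Qed.

Section Sections.
Variables (V W : finType) (X : span V V) (R : span V W) (S : span W V).
Variable k : nat.
Variable (g : piso (R ** S) (powS X k)).

Lemma walk_from n v : (forall v, {x : X | src x = v}) ->
  {y : seq X * V | walk v y.1 y.2 & size y.1 = n}.
Proof.
move=> out; elim: n v => [|n IH] v; first by exists ([::], v).
have [a ea] := out v; have [[l w] /= h sl] := IH (rng a).
by exists (a :: l, w); rewrite //= sl.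
Qed.

Lemma walk_to n w : (forall v, {x : X | rng x = v}) ->
  {y : V * seq X | walk y.1 y.2 w & size y.2 = n}.
Proof.
move=> into; elim: n w => [|n IH] w; first by exists (w, [::]).
have [a ea] := into w; have [[v l] /= h sl] := IH (src a).
exists (v, rcons l a); last by rewrite size_rcons sl.
by rewrite -cats1; apply/walk_cat; exists (src a).
Qed.

(** Decode by [g] a path of length k + 1 that starts at [v]. *)
Lemma out_first : (forall v, {x : X | src x = v}) ->
  forall v, {r : R | src r = v}.
Proof.
move=> out v; have [[l w] /= h sl] := walk_from k.+1 v out.
have [[r s] /= c] := cut_onto g h sl; exists r.
by have [_ h' _] := cut_ends c; have [] := walk_ends h' h sl.
Qed.

Lemma in_second : (forall v, {x : X | rng x = v}) ->
  forall v, {s : S | rng s = v}.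
Proof.
move=> into w; have [[v l] /= h sl] := walk_to k.+1 w into.
have [[r s] /= c] := cut_onto g h sl; exists s.
by have [_ h' _] := cut_ends c; have [] := walk_ends h' h sl.
Qed.
End Sections.

Lemma essential_out (V W : finType) (F : natmx V W) : essential F ->
  forall v, {e : edges F | src e = v}.
Proof.
move=> [h _] v; have [w] : {w | 0 < F v w}.
  by apply: sigW; have [w /eqP] := h v; exists w; rewrite lt0n.
by move=> hw; exists (exist _ (v, 0, w) hw).
Qed.

Lemma essential_in (V W : finType) (F : natmx V W) : essential F ->
  forall w, {e : edges F | rng e = w}.
Proof.
move=> [_ h] w; have [v] : {v | 0 < F v w}.
  by apply: sigW; have [v /eqP] := h w; exists v; rewrite lt0n.
by move=> hv; exists (exist _ (v, 0, w) hv).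
Qed.

Section ShiftRelations.
Variables (V W : finType) (A : natmx V V) (B : natmx W W) (m : nat).
Hypotheses (hA : essential A) (hB : essential B).

Lemma aligned_balanced_related :
  aligned_shift_related A B m -> balanced_shift_related A B m.
Proof. by move=> [c [h1 h2]]; exists c; split; apply: aligned_balanced. Qed.

Lemma balanced_compatible_related :
  balanced_shift_related A B m -> compatible_shift_related A B m.
Proof.
move=> [[R S fR fS gA gB] [/= h _]].
(* In the domain of psi_B the factor [S] comes first and [R] second. *)
have outS := out_first gB (essential_out hB).
have inR := in_second gB (essential_in hB).
have [gB' [h1 h2]] := balanced_compatible h outS inR.
by exists (ConcreteShift fR fS gA gB').
Qed.

Lemma compatible_aligned_related :
  compatible_shift_related A B m -> aligned_shift_related A B m.
Proof.
move=> [c [h1 h2]]; exists c; split.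
  exact: compatible_aligned (essential_out hA) h1 h2.
exact: compatible_aligned (essential_out hB) h2 h1.
Qed.

Lemma compatible_related_sse :
  compatible_shift_related A B m -> strong_shift_equivalent A B.
Proof.
move=> [[R S fR fS gA gB] [/= h _]]; apply: compatible_edges_sse h _ _.
  by move=> v; have [r] := out_first gA (essential_out hA) v; exists r.
by move=> w; have [r] := in_second gB (essential_in hB) w; exists r.
Qed.
End ShiftRelations.

Theorem theorem1 (V W : finType) (A : natmx V V) (B : natmx W W) (m : nat)
    (hA : essential A) (hB : essential B) (hm : 0 < m) :
  ((aligned_shift_related A B m <-> balanced_shift_related A B m) /\
   (balanced_shift_related A B m <-> compatible_shift_related A B m)) /\
  ((exists2 l, 0 < l & aligned_shift_related A B l) <->
     strong_shift_equivalent A B) /\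
  ((exists2 l, 0 < l & balanced_shift_related A B l) <->
     strong_shift_equivalent A B).
Proof.
have ab l := @aligned_balanced_related V W A B l.
have bc l := @balanced_compatible_related V W A B l hB.
have ca l := @compatible_aligned_related V W A B l hA hB.
have cs l := @compatible_related_sse V W A B l hA hB.
have sa := @sse_aligned V W A B.
split; first by split; split; auto.
split; split=> [[l _ h]|/sa [l l0 h]]; first by apply/(cs l)/bc/ab.
- by exists l.
- by apply/(cs l)/bc.
- by exists l => //; apply: ab.
Qed.
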